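(* (a) If $A$ is a commutative R$^*$-algebra, then the projection lattice $\mathcal{P}(A)$ is a generalized Boolean algebra. (b) Every generalized Boolean algebra is lattice isomorphic to $\mathcal{P}(A)$ for some commutative R$^*$-algebra $A$. (c) Two commutative R$^*$-algebras are $^*$-isomorphic if and only if their projection lattices are lattice isomorphic. (d) A commutative R$^*$-algebra $A$ is unital if and only if $\mathcal{P}(A)$ is a Boolean algebra.
   Context: An R$^*$-algebra is a (not necessarily closed, not necessarily unital) $^*$-subalgebra $A$ of $B(H)$ for some complex Hilbert space $H$ such that for every $x\in A$ there is $y\in A$ with $xyx=x$ (equivalently every self-adjoint element of $A$ has finite spectrum). $\mathcal{P}(A)=\{p\in A:p=p^2=p^*\}$, ordered by $p\le q$ iff $pq=p$; it is a lattice. A generalized field of sets is a nonempty family $\mathcal{S}\subset 2^X$ with $S\cap T, S\cup T, S\setminus T\in\mathcal{S}$ for all $S,T\in\mathcal{S}$; a generalized Boolean algebra is a lattice isomorphic to a generalized field of sets. A Boolean algebra is an orthocomplemented lattice orthoisomorphic to a field of sets (nonempty family closed under intersection, union and complement in $X$). A $^*$-isomorphism is a linear multiplicative $^*$-preserving bijection. *)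

(* Defs.v *)
From mathcomp Require Import all_boot all_algebra.
From mathcomp Require Import complex reals.
Set Implicit Arguments. Unset Strict Implicit. Unset Printing Implicit Defensive.
Import GRing.Theory Num.Theory.
Local Open Scope ring_scope.
Local Open Scope complex_scope.

(* A complex Hilbert space: a complex vector space with an inner product
   (linear in the first argument, conjugate symmetric, positive definite)
   which is complete for the induced norm ||x||^2 = <x,x>.  Distances are
   compared through their squares (equivalent, since e > 0). *)
Record hilbert (R : realType) := Hilbert {
  hvec : lmodType R[i];
  hinner : hvec -> hvec -> R[i];
  hinnerDl : forall (a : R[i]) (x y z : hvec),
      hinner (a *: x + y) z = a * hinner x z + hinner y z;
  hinnerC : forall x y, hinner y x = (hinner x y)^*;
  hinner_ge0 : forall x, 0 <= hinner x x;
  hinner_eq0 : forall x, hinner x x = 0 -> x = 0;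
  hcomplete : forall u : nat -> hvec,
      (forall e : R[i], 0 < e -> exists N : nat, forall m n : nat,
          (N <= m)%N -> (N <= n)%N -> hinner (u m - u n) (u m - u n) < e) ->
      exists x : hvec, forall e : R[i], 0 < e -> exists N : nat, forall n : nat,
          (N <= n)%N -> hinner (u n - x) (u n - x) < e
}.

Section Ops.
Variable R : realType.
Variable H : hilbert R.

Definition op := hvec H -> hvec H.

Definition bounded_op (T : op) : Prop :=
  (forall (a : R[i]) (x y : hvec H), T (a *: x + y) = a *: T x + T y) /\
  (exists M : R[i], forall x, hinner (T x) (T x) <= M * hinner x x).

Definition is_adjoint (T S : op) : Prop :=
  forall x y, hinner (T x) y = hinner x (S y).

Definition Rstar_alg (A : op -> Prop) : Prop :=
  [/\ (forall T, A T -> bounded_op T),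
      A (fun _ => 0) /\
      (forall (a : R[i]) S T, A S -> A T -> A (fun x => a *: S x + T x)),
      (forall S T, A S -> A T -> A (S \o T)),
      (forall T, A T -> exists S, A S /\ is_adjoint T S) &
      (forall T, A T -> exists S, A S /\ T \o S \o T = T)].

Definition commutative_alg (A : op -> Prop) : Prop :=
  forall S T, A S -> A T -> S \o T = T \o S.

Definition unital_alg (A : op -> Prop) : Prop :=
  exists E, A E /\ forall T, A T -> E \o T = T /\ T \o E = T.

Definition projs (A : op -> Prop) : op -> Prop :=
  fun p => A p /\ p \o p = p /\ is_adjoint p p.

Definition proj_le (p q : op) : Prop := p \o q = p.

End Ops.

Definition star_iso (R : realType) (H1 H2 : hilbert R)
  (A : op H1 -> Prop) (B : op H2 -> Prop) : Prop :=
  exists phi : op H1 -> op H2,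
    [/\ (forall T, A T -> B (phi T)),
        (forall S T, A S -> A T -> phi S = phi T -> S = T),
        (forall U, B U -> exists T, A T /\ phi T = U) /\
        (forall (a : R[i]) S T, A S -> A T ->
           phi (fun x => a *: S x + T x) = (fun y => a *: phi S y + phi T y)),
        (forall S T, A S -> A T -> phi (S \o T) = phi S \o phi T) &
        (forall T S, A T -> A S -> is_adjoint T S ->
           is_adjoint (phi T) (phi S))].

(* order (= lattice) isomorphism between (D, le) and (E, le') *)
Definition order_iso (T U : Type) (D : T -> Prop) (le : T -> T -> Prop)
  (E : U -> Prop) (le' : U -> U -> Prop) : Prop :=
  exists f : T -> U,
    [/\ (forall x, D x -> E (f x)),
        (forall x y, D x -> D y -> f x = f y -> x = y),
        (forall z, E z -> exists x, D x /\ f x = z) &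
        (forall x y, D x -> D y -> (le x y <-> le' (f x) (f y)))].

Definition set_incl (X : Type) (s t : X -> Prop) : Prop := forall x, s x -> t x.

Definition gen_field_of_sets (X : Type) (S : (X -> Prop) -> Prop) : Prop :=
  (exists s, S s) /\
  (forall s t, S s -> S t ->
     [/\ S (fun x => s x /\ t x), S (fun x => s x \/ t x) &
         S (fun x => s x /\ ~ t x)]).

Definition field_of_sets (X : Type) (S : (X -> Prop) -> Prop) : Prop :=
  [/\ (exists s, S s),
      (forall s t, S s -> S t -> S (fun x => s x /\ t x)),
      (forall s t, S s -> S t -> S (fun x => s x \/ t x)) &
      (forall s, S s -> S (fun x => ~ s x))].

Definition is_gen_boolean (T : Type) (D : T -> Prop) (le : T -> T -> Prop) : Prop :=
  exists (X : Type) (S : (X -> Prop) -> Prop),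
    gen_field_of_sets S /\ order_iso D le S (@set_incl X).

Definition is_boolean (T : Type) (D : T -> Prop) (le : T -> T -> Prop) : Prop :=
  exists (X : Type) (S : (X -> Prop) -> Prop),
    field_of_sets S /\ order_iso D le S (@set_incl X).

(* Main.v *)
From HB Require Import structures.
Require Import Defs.
From mathcomp Require Import all_boot all_order all_algebra finmap.
From mathcomp Require Import boolp classical_sets functions.
From mathcomp Require Import complex reals.
From mathcomp Require Import ring lra.

(** In a commutative R*-algebra every element is a linear combination of
    projections: for self-adjoint [T], split off projections on whose ranges [T]
    is scalar and let [m] be the infimum of the upper form bounds of [T] on the
    remaining ranges.  Regularity makes [T - m] bounded below off its kernel, so
    the form of [T] cannot have values near [m] there, and [m] could be lowered.
    A linear relation between commuting projections can be tested on an
    orthogonal refinement of them, so a lattice isomorphism extends linearly to a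
    *-isomorphism.  Projections are separated by prime filters, which gives the
    field of sets; conversely a generalized field of sets on [X] acts on l2(X) by
    multiplication by functions with finitely many values. *)

Set Implicit Arguments. Unset Strict Implicit. Unset Printing Implicit Defensive.
Import Order.TTheory GRing.Theory Num.Theory.
Local Open Scope ring_scope.
Local Open Scope complex_scope.

(** * Real inner product and self-adjoint operators *)

(** A limit of elements may leave the algebra, so spectral projections cannot be built by
    approximation. Regularity is the substitute: if [T S T = T], then [S T] is idempotent, hence a
    projection, and the operator bound of [S] makes [T] bounded below on its range. Applied to
    [T - m], this meets a Cauchy-Schwarz estimate for the positive form of [m + e - T]: a vector
    where this form is small is nearly killed by [T - m]. So no finite infimum [m] can exist; the
    upper form bounds are unbounded below, and since [T] is bounded, some remaining range is zero.

    The possible absence of a unit shapes the constructions: a support projection replaces the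
    identity, filters are axiomatised with differences instead of complements, and the zero level
    set of a simple function is left unconstrained. An order isomorphism only sees meets and joins;
    it becomes algebraic because the product of commuting projections is their meet and the sum of
    orthogonal ones is their join. *)

Section RealInnerProduct.
Variables (R : realType) (H : hilbert R).
Implicit Types (x y z : hvec H) (T S : op H).

Lemma hinnerD x y z : hinner (x + y) z = hinner x z + hinner y z.
Proof. by rewrite -[x]scale1r hinnerDl mul1r scale1r. Qed.

Lemma hinner0 z : hinner 0 z = 0.
Proof. by apply: (addrI (hinner 0 z)); rewrite -hinnerD !addr0. Qed.

Lemma hinnerZ a x z : hinner (a *: x) z = a * hinner x z.
Proof. by rewrite -[a *: x]addr0 hinnerDl hinner0 addr0. Qed.

Lemma hinnerN x z : hinner (- x) z = - hinner x z.
Proof. by rewrite -scaleN1r hinnerZ mulN1r. Qed.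

Lemma hinnerDr x y z : hinner z (x + y) = hinner z x + hinner z y.
Proof. by rewrite hinnerC hinnerD rmorphD /= -!hinnerC. Qed.

Lemma hinnerZr a x z : hinner z (a *: x) = conjc a * hinner z x.
Proof. by rewrite hinnerC hinnerZ rmorphM /= -hinnerC. Qed.

Lemma hinnerNr x z : hinner z (- x) = - hinner z x.
Proof. by rewrite hinnerC hinnerN rmorphN /= -hinnerC. Qed.

Lemma hinner0r z : hinner z 0 = 0.
Proof. by rewrite hinnerC hinner0 conjc0. Qed.

Lemma is_adjoint_sym T S : is_adjoint T S -> is_adjoint S T.
Proof. by move=> a x y; rewrite hinnerC -a -hinnerC. Qed.

Lemma is_adjoint_inj T S S' : is_adjoint T S -> is_adjoint T S' -> S = S'.
Proof.
move=> a a'; apply/funext => y; apply/eqP; rewrite -subr_eq0; apply/eqP.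
by apply: hinner_eq0; rewrite hinnerDr hinnerNr -a -a' subrr.
Qed.

Lemma is_adjoint_lin a T S T' S' : is_adjoint T T' -> is_adjoint S S' ->
  is_adjoint (fun x => a *: T x + S x) (fun x => conjc a *: T' x + S' x).
Proof.
by move=> h k x y; rewrite hinnerD hinnerZ hinnerDr hinnerZr conjcK h k.
Qed.

(** The real part is a real inner product, so form estimates become polynomial inequalities over
    [R]. *)
Definition rip x y : R := complex.Re (hinner x y).

Lemma ReD (a b : R[i]) : complex.Re (a + b) = complex.Re a + complex.Re b.
Proof. by case: a; case: b. Qed.

Lemma ripC x y : rip x y = rip y x.
Proof. by rewrite /rip hinnerC; case: (hinner y x). Qed.

Lemma ripD x y z : rip (x + y) z = rip x z + rip y z.
Proof. by rewrite /rip hinnerD ReD. Qed.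

Lemma ripZ (r : R) x z : rip (r%:C *: x) z = r * rip x z.
Proof. by rewrite /rip hinnerZ; case: (hinner x z) => a b /=; rewrite mul0r subr0. Qed.

Lemma ripN x z : rip (- x) z = - rip x z.
Proof. by rewrite /rip hinnerN; case: (hinner x z). Qed.

Lemma ripDr x y z : rip z (x + y) = rip z x + rip z y.
Proof. by rewrite ripC ripD !(ripC z). Qed.

Lemma ripZr (r : R) x z : rip z (r%:C *: x) = r * rip z x.
Proof. by rewrite ripC ripZ (ripC z). Qed.

Lemma ripNr x z : rip z (- x) = - rip z x.
Proof. by rewrite ripC ripN (ripC z). Qed.

Definition ripE := (ripD, ripN, ripZ, ripDr, ripNr, ripZr).

Lemma hinner_real x : hinner x x = (rip x x)%:C.
Proof.
rewrite /rip [LHS]complexE ger0_Im ?hinner_ge0 //.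
by rewrite (_ : 0%:C = 0) // mulr0 addr0.
Qed.

Lemma rip_ge0 x : 0 <= rip x x.
Proof. by have := hinner_ge0 x; rewrite hinner_real ler0c. Qed.

Lemma rip_eq0 x : rip x x = 0 -> x = 0.
Proof. by move=> h; apply: hinner_eq0; rewrite hinner_real h. Qed.

Lemma rip0 x : rip 0 x = 0. Proof. by rewrite /rip hinner0. Qed.

Lemma bounded_op_rip T : bounded_op T ->
  exists2 M : R, 0 <= M & forall x, rip (T x) (T x) <= M * rip x x.
Proof.
(* The bound [M] is a complex number; comparison of real parts is all that the complex order gives
   here. *)
case=> _ [M hM]; exists (Num.max 0 (complex.Re M)) => [|x].
  by rewrite le_max lexx.
apply: (@le_trans _ _ (complex.Re M * rip x x)); last first.
  by rewrite ler_wpM2r ?rip_ge0 // le_max lexx orbT.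
have := hM x; rewrite lecE => /andP[_]; rewrite (hinner_real x).
by case: (M) => a b /=; rewrite mulr0 subr0.
Qed.

End RealInnerProduct.

(** * Projections of a commutative R*-algebra *)

Section CommutativeRstar.
Variables (R : realType) (H : hilbert R) (A : op H -> Prop).
Hypotheses (hA : Rstar_alg A) (cA : commutative_alg A).
Implicit Types (x y : hvec H) (T S p q r e : op H).

Notation P := (projs A).

Lemma alg_opP T : A T -> forall a x y, T (a *: x + y) = a *: T x + T y.
Proof. by case: hA => b _ _ _ _ /b [l _]; exact: l. Qed.

Lemma alg_opD T : A T -> forall x y, T (x + y) = T x + T y.
Proof. by move=> h x y; rewrite -[x]scale1r (alg_opP h) !scale1r. Qed.

Lemma alg_op0 T : A T -> T 0 = 0.
Proof. by move=> h; apply: (addrI (T 0)); rewrite -(alg_opD h) !addr0. Qed.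

Lemma alg_opZ T : A T -> forall a x, T (a *: x) = a *: T x.
Proof.
by move=> h a x; rewrite -[a *: x]addr0 (alg_opP h) (alg_op0 h) addr0.
Qed.

Lemma alg_opN T : A T -> forall x, T (- x) = - T x.
Proof. by move=> h x; rewrite -scaleN1r (alg_opZ h) scaleN1r. Qed.

Lemma alg_opB T : A T -> forall x y, T (x - y) = T x - T y.
Proof. by move=> h x y; rewrite (alg_opD h) (alg_opN h). Qed.

Lemma alg_comm T S : A T -> A S -> forall x, T (S x) = S (T x).
Proof. by move=> hT hS x; exact: (congr1 (@^~ x) (cA hT hS)). Qed.

Lemma alg_zero : A (fun=> 0).
Proof. by case: hA => _ [? _]. Qed.

Lemma alg_lin a T S : A T -> A S -> A (fun x => a *: T x + S x).
Proof. by case: hA => _ [_ h] _ _ _; exact: h. Qed.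

Lemma alg_comp T S : A T -> A S -> A (T \o S).
Proof. by case: hA => _ _ h _ _; exact: h. Qed.

Lemma alg_add T S : A T -> A S -> A (fun x => T x + S x).
Proof.
move=> hT /(alg_lin 1 hT); congr (A _).
by apply/funext => x; rewrite scale1r.
Qed.

Lemma alg_scale a T : A T -> A (fun x => a *: T x).
Proof.
move=> /(alg_lin a)/(_ alg_zero); congr (A _).
by apply/funext => x; rewrite addr0.
Qed.

Lemma alg_sub T S : A T -> A S -> A (fun x => T x - S x).
Proof.
move=> hT hS; have := alg_lin (-1) hS hT; congr (A _).
by apply/funext => x; rewrite scaleN1r addrC.
Qed.

(* A commutative *-algebra consists of normal operators, so an idempotent and
   its adjoint have the same kernel. *)
Lemma projs_idem e : A e -> (forall x, e (e x) = e x) -> P e.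
Proof.
move=> he ee; split=> //; split; first exact/funext.
case: hA => _ _ _ /(_ _ he) [s [hs a]] _; have a' := is_adjoint_sym a.
have ker x : e x = 0 -> s x = 0.
  move=> ex0; apply: hinner_eq0.
  by rewrite a' (alg_comm he hs) ex0 (alg_op0 hs) hinner0r.
have se x : s x = s (e x).
  apply/eqP; rewrite -subr_eq0 -(alg_opB hs); apply/eqP/ker.
  by rewrite (alg_opB he) ee subrr.
by move=> x y; rewrite a se -a -[RHS]a' se a'.
Qed.

Lemma projs_alg p : P p -> A p. Proof. by case. Qed.

Lemma projsK p : P p -> forall x, p (p x) = p x.
Proof. by case=> _ [h _] x; exact: (congr1 (@^~ x) h). Qed.

Lemma projs_comm p q : P p -> P q -> forall x, p (q x) = q (p x).
Proof. by move=> [hp _] [hq _]; exact: alg_comm. Qed.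

Lemma projs_zero : P (fun=> 0).
Proof. by apply: projs_idem => //; exact: alg_zero. Qed.

Lemma projs_comp p q : P p -> P q -> P (p \o q).
Proof.
move=> hp hq; apply: projs_idem => [|x /=].
  by apply: alg_comp; exact: projs_alg.
by rewrite -(projs_comm hp hq) (projsK hp) (projsK hq).
Qed.

Lemma projs_diff p q : P p -> P q -> P (fun x => p x - p (q x)).
Proof.
move=> hp hq; have [[Ap _] [Aq _]] := (hp, hq); apply: projs_idem => [|x].
  by apply: alg_sub => //; exact: (alg_comp Ap Aq).
rewrite (alg_opB Ap) (alg_opB Aq) (alg_opB Ap) -!(projs_comm hp hq).
by rewrite !(projsK hp) (projsK hq) subrr subr0.
Qed.

Lemma projs_orth_add p q : P p -> P q -> (forall x, p (q x) = 0) ->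
  P (fun x => p x + q x).
Proof.
move=> hp hq pq; have [[Ap _] [Aq _]] := (hp, hq); apply: projs_idem => [|x].
  exact: alg_add.
rewrite (alg_opD Ap) (alg_opD Aq) (projsK hp) (projsK hq).
by rewrite -(projs_comm hp hq) pq addr0 add0r.
Qed.

(** * Linear combinations of projections *)

Definition all_projs (l : seq (R[i] * op H)) : Prop :=
  foldr (fun j Q => P j.2 /\ Q) True l.

(** The target [V] is left open so that one list can be evaluated at a vector, and also after each
    projection is replaced by its image under some map. *)
Definition comb (V : lmodType R[i]) (f : op H -> V) (l : seq (R[i] * op H)) : V :=
  \sum_(j <- l) j.1 *: f j.2.

Definition spanned T : Prop :=
  exists2 l, all_projs l & T = fun x => comb (@^~ x) l.

Lemma all_projs_cat l l' : all_projs l -> all_projs l' -> all_projs (l ++ l').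
Proof. by elim: l => //= j l IH [hj hl] hl'; split => //; exact: IH. Qed.

Definition scale_list (a : R[i]) (l : seq (R[i] * op H)) :=
  [seq (a * j.1, j.2) | j <- l].

Lemma all_projs_scale a l : all_projs l -> all_projs (scale_list a l).
Proof. by elim: l => //= j l IH [hj hl]; split => //; exact: IH. Qed.

Lemma comb_cons (V : lmodType R[i]) (f : op H -> V) j l :
  comb f (j :: l) = j.1 *: f j.2 + comb f l.
Proof. exact: big_cons. Qed.

Lemma comb_nil (V : lmodType R[i]) (f : op H -> V) : comb f [::] = 0.
Proof. exact: big_nil. Qed.

Lemma comb_cat (V : lmodType R[i]) (f : op H -> V) l l' :
  comb f (l ++ l') = comb f l + comb f l'.
Proof. exact: big_cat. Qed.

Lemma comb_scale (V : lmodType R[i]) (f : op H -> V) a l :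
  comb f (scale_list a l) = a *: comb f l.
Proof.
by rewrite /comb big_map scaler_sumr; apply: eq_bigr => j _; rewrite scalerA.
Qed.

Lemma alg_comb l : all_projs l -> A (fun x => comb (@^~ x) l).
Proof.
elim: l => [_|[a p] l IH /= [[hp _] /IH hl]].
  by have := alg_zero; congr (A _); apply/funext => x; rewrite comb_nil.
have := alg_lin a hp hl; congr (A _).
by apply/funext => x; rewrite comb_cons.
Qed.

Lemma spanned_lin a T S : spanned T -> spanned S ->
  spanned (fun x => a *: T x + S x).
Proof.
move=> [l hl ->] [l' hl' ->]; exists (scale_list a l ++ l').
  by apply: all_projs_cat => //; exact: all_projs_scale.
by apply/funext => x; rewrite comb_cat comb_scale.
Qed.

Lemma spanned_zero : spanned (fun=> 0).
Proof. by exists [::] => //; apply/funext => x; rewrite comb_nil. Qed.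

Lemma spanned_proj a p : P p -> spanned (fun x => a *: p x).
Proof.
move=> hp; exists [:: (a, p)] => //=.
by apply/funext => x; rewrite comb_cons comb_nil addr0.
Qed.

(** With a quasi-inverse [S], the idempotent [S \o T] is the support of [T]: multiplying [T] by it
    on either side changes nothing. *)
Lemma support_proj T : A T -> exists2 S, A S &
  [/\ P (S \o T), (forall x, T (S (T x)) = T x) & (forall x, S (T (T x)) = T x)].
Proof.
move=> hT; case: hA => _ _ _ _ /(_ _ hT) [S [hS e]]; exists S => //.
have tst x : T (S (T x)) = T x by exact: (congr1 (@^~ x) e).
split=> // [|x]; last by rewrite -(alg_comm hT hS) tst.
by apply: projs_idem => [|x /=]; [exact: alg_comp | rewrite tst].
Qed.

Lemma form_bound T : A T ->
  exists2 M : R, 0 <= M & forall x, `|rip (T x) x| <= M * rip x x.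
Proof.
move=> hT; case: hA => /(_ _ hT)/bounded_op_rip[M M0 hM] _ _ _ _.
(* Expanding the squared norms of [T x + x] and [T x - x] bounds twice the form by
   [|T x|^2 + |x|^2]. *)
exists ((M + 1) / 2) => [|x]; first lra.
have := rip_ge0 (T x + x); have := rip_ge0 (T x - x); rewrite !ripE.
rewrite (ripC x (T x)) => h1 h2; have := hM x.
rewrite ler_norml => h3; apply/andP; split; nra.
Qed.

(** * Diagonalisation of self-adjoint elements *)

Section SelfAdjoint.
Variables (T : op H).
Hypotheses (AT : A T) (saT : is_adjoint T T).

Lemma rip_sa x y : rip (T x) y = rip x (T y).
Proof. by rewrite /rip saT. Qed.

(* A projection [h] is good at level [t] when [T] is already diagonalised off
   the range of [h] and its quadratic form is at most [t] on that range. *)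
Definition good (e : op H) (t : R) (h : op H) : Prop :=
  [/\ P h, forall x, h (e x) = h x, spanned (fun x => T x - T (h x)) &
      forall x, rip (T (h x)) (h x) <= t * rip (h x) (h x)].

(** Here [f] is the support of [T - m e], where [e] stands in for the identity. Boundedness of the
    quasi-inverse gives the lower bound on the range of [f]. On the rest of the range of [e], [T] is
    the scalar [m], so replacing [h] by [h \o f] merely splits off the projection [h - h \o f] with
    coefficient [m]. *)
Lemma good_kernel (e : op H) (m : R) : P e -> (forall x, T (e x) = T x) ->
  exists2 f, P f & [/\
    (exists2 C : R, 0 <= C & forall x, f x = x ->
        rip x x <= C * rip (T x - m%:C *: x) (T x - m%:C *: x)) &
    forall t h, good e t h -> good e t (h \o f)].
Proof.
move=> Pe Te; have Ae := projs_alg Pe.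
have eT x : e (T x) = T x by rewrite (alg_comm Ae AT) Te.
pose y x := T x - m%:C *: e x.
have Ay : A y by apply: alg_sub => //; exact: alg_scale.
have [S AS [Pf ySy Syy]] := support_proj Ay.
have ye x : y (e x) = y x by rewrite /y Te (projsK Pe).
exists (S \o y) => //; split.
  have bS : bounded_op S by case: hA => b _ _ _ _; exact: b.
  have [C C0 hC] := bounded_op_rip bS; exists C => // x fx.
  have ex : e x = x.
    by rewrite -fx /= (alg_comm Ae AS) (alg_comm Ae Ay) ye.
  by have := hC (y x); rewrite /= in fx; rewrite fx /y ex.
move=> t h [Ph he hs hf]; have Ah := projs_alg Ph.
have Af := projs_alg Pf.
have Tf x : T (S (y x)) = T x - m%:C *: (e x - S (y x)).
  have := ySy x; rewrite {1}/y => /eqP; rewrite subr_eq => /eqP ->.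
  have -> : e (S (y x)) = S (y x).
    by rewrite (alg_comm Ae AS) (alg_comm Ae Ay) ye.
  by rewrite /y scalerBr opprB addrA addrAC.
split=> [|x /=||x /=].
- exact: projs_comp.
- by rewrite ye.
- have hT : P (fun x => h x - h (S (y x))) by exact: (projs_diff Ph Pf).
  suff <- : (fun x => 1 *: (T x - T (h x)) + m%:C *: (h x - h (S (y x)))) =
            (fun x => T x - T ((h \o (S \o y)) x)).
    exact: spanned_lin hs (spanned_proj m%:C hT).
  apply/funext => x /=; rewrite scale1r !(alg_comm AT Ah).
  rewrite Tf (alg_opB Ah) (alg_opZ Ah) (alg_opB Ah) he.
  by rewrite opprB addrAC addrA.
- by have := hf (S (y x)).
Qed.

Lemma rip_sub_le x y : rip (x - y) (x - y) <= 2 * rip x x + 2 * rip y y.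
Proof. by have := rip_ge0 (x + y); rewrite !ripE (ripC y x); lra. Qed.

(** Let [Q] be the form of [m + e - T], nonnegative on the range of [h], and [v = (m + e) x - T x].
    Then [Q(x, v) = |v|^2], and Cauchy-Schwarz in the form [|v|^2 <= N Q(x, x)] holds. As
    [Q(x, x) <= 2 e |x|^2] and [T x - m x = e x - v], the estimate follows. *)
Lemma spectral_gap (m N e : R) h x :
  0 < N -> 0 <= e -> P h -> h x = x ->
  (forall v, rip (T (h v)) (h v) <= (m + e) * rip (h v) (h v)) ->
  (forall v, (m + e) * rip v v - rip (T v) v <= N * rip v v) ->
  (m - e) * rip x x <= rip (T x) x ->
  rip (T x - m%:C *: x) (T x - m%:C *: x) <= (2 * e ^+ 2 + 4 * N * e) * rip x x.
Proof.
move=> N0 e0 Ph hx hle hN hge; have Ah := projs_alg Ph.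
have [v vE] : {v | v = (m + e)%:C *: x - T x} by exists ((m + e)%:C *: x - T x).
have hv : h v = v by rewrite vE (alg_opB Ah) (alg_opZ Ah) -(alg_comm AT Ah) hx.
have -> : T x - m%:C *: x = e%:C *: x - v.
  by rewrite vE rmorphD scalerDl opprB addrCA opprD [- _ - _]addrC addNKr.
apply: (le_trans (rip_sub_le _ _)).
have nv : rip v v = (m + e) * rip x v - rip (T x) v by rewrite {1}vE !ripE.
have pw : rip x v = (m + e) * rip x x - rip (T x) x.
  by rewrite vE !ripE (ripC x (T x)).
have key : rip v v <= N * rip x v.
  (* The step [s = 1 / N] minimises the upper bound [Q(x, x) - 2 s |v|^2 + s^2 N |v|^2] for [Q] at
     [x - s v]. *)
  have := hle (x - N^-1%:C *: v).
  have -> : h (x - N^-1%:C *: v) = x - N^-1%:C *: v.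
    by rewrite (alg_opB Ah) (alg_opZ Ah) hx hv.
  rewrite (alg_opB AT) (alg_opZ AT) !ripE (ripC v x) (rip_sa v x) (ripC v (T x)).
  have := hN v; have Ni : N * N^-1 = 1 by rewrite divff // gt_eqF.
  have : 0 < N^-1 by rewrite invr_gt0.
  move: (N^-1) Ni => i Ni i0 h1 h2.
  have : i * (2 * rip v v) <= rip x v + i * (i * ((m + e) * rip v v - rip (T v) v)).
    by rewrite nv pw; nra.
  have : i * (i * ((m + e) * rip v v - rip (T v) v)) <= i * rip v v.
    rewrite ler_pM2l //; have := ler_wpM2l (ltW i0) h1.
    by rewrite mulrA (mulrC i N) Ni mul1r.
  move=> h3 h4; have h5 : i * rip v v <= rip x v by lra.
  have := ler_wpM2l (ltW N0) h5; by rewrite mulrA Ni mul1r.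
rewrite !ripE; have : N * rip x v <= N * (2 * e * rip x x).
  by rewrite ler_pM2l //; lra.
lra.
Qed.

End SelfAdjoint.

Lemma spanned_sa T : A T -> is_adjoint T T -> spanned T.
Proof.
move=> AT saT; have [S AS [Pe _ Te]] := support_proj AT.
have {}Te x : T ((S \o T) x) = T x by rewrite /= (alg_comm AT AS) Te.
move: (S \o T) Pe Te => e Pe Te.
have [M M0 hM] := form_bound AT.
have hMle x : rip (T x) x <= M * rip x x.
  exact: le_trans (ler_norm _) (hM x).
have hMge x : - M * rip x x <= rip (T x) x.
  by have := hM x; rewrite ler_norml mulNr => /andP[].
pose G : set R := fun t => exists h, good T e t h.
have G0 : G M.
  exists e; split=> //; first by move=> x; rewrite (projsK Pe).
  suff -> : (fun x => T x - T (e x)) = (fun=> 0) by exact: spanned_zero.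
  by apply/funext => x; rewrite Te subrr.
(* If [G] is unbounded below, some level lies under every form value of [T]; the remaining range is
   then zero and [T] itself is spanned. A lower bound of [G] will lead to a contradiction. *)
have [Gb|] := pselect (has_lbound G); last first.
  move=> nb.
  have [t [[h [Ph _ hs hf]] tM]] : exists t, G t /\ t < - M - 1.
    apply: contrapT => nt; apply: nb; exists (- M - 1) => t Gt.
    by rewrite leNgt; apply/negP => tM; apply: nt; exists t.
  have h0 x : h x = 0.
    apply: rip_eq0; have := hf x; have := hMge (h x); have := rip_ge0 (h x).
    nra.
  suff <- : (fun x => T x - T (h x)) = T by [].
  by apply/funext => x; rewrite h0 (alg_op0 AT) subr0.
have infG : has_inf G by split => //; exists M.
pose m := inf G; have [f Pf [[C C0 hC] gf]] := good_kernel AT m Pe Te.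
(* [N] bounds the form of [m + e0 - T] because [e0 <= 1]; [e0] is chosen so that [C (2 e0^2 + 4 N
   e0) <= C (2 + 4 N) e0 = 1 - e0 < 1], against the lower bound with constant [C]. *)
pose N := `|m| + 1 + M; have N0 : 0 < N by rewrite /N; have := normr_ge0 m; lra.
pose e0 := (1 + C * (2 + 4 * N))^-1.
have D0 : 0 <= C * (2 + 4 * N) by apply: mulr_ge0 => //; lra.
have e00 : 0 < e0 by rewrite invr_gt0; lra.
have e01 : e0 <= 1 by rewrite invf_le1; lra.
have e0E : e0 * (1 + C * (2 + 4 * N)) = 1 by rewrite mulVf //; lra.
have [t [h gh] tlt] := inf_adherent e00 infG.
have [Ph he hs hf] := gf _ _ gh.
set k := h \o f in Ph he hs hf.
have Ah := projs_alg Ph; have Af := projs_alg Pf.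
(* Otherwise [k] would be good at level [m - e0], below the infimum. *)
have [w hw] : exists w, (m - e0) * rip (k w) (k w) < rip (T (k w)) (k w).
  apply: contrapT => nw; have : G (m - e0).
    exists k; split=> // x; rewrite leNgt; apply/negP => lt.
    by apply: nw; exists x.
  by move=> /(inf_lbound infG.2); rewrite -/m; lra.
have kk : k (k w) = k w by rewrite (projsK Ph).
have fk : f (k w) = k w.
  rewrite /k /= (alg_comm Af (projs_alg (let: And4 a _ _ _ := gh in a))).
  by rewrite (projsK Pf).
have r0 : 0 < rip (k w) (k w).
  rewrite lt_def rip_ge0 andbT; apply/eqP => /rip_eq0 z.
  by move: hw; rewrite z (alg_op0 AT) rip0 mulr0 ltxx.
have gap := @spectral_gap T AT saT m N e0 k (k w) N0 (ltW e00) Ph kk.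
have : rip (T (k w) - m%:C *: k w) (T (k w) - m%:C *: k w) <=
    (2 * e0 ^+ 2 + 4 * N * e0) * rip (k w) (k w).
  apply: gap; last exact: ltW.
    move=> v; apply: (le_trans (hf v)); rewrite ler_wpM2r ?rip_ge0 //.
    by rewrite -/m in tlt; exact: ltW.
  move=> v; have := hMge v; have := rip_ge0 v; have := ler_norm m.
  by rewrite /N; move: `|m| => nm; nra.
move=> /(ler_wpM2l C0) /(le_trans (hC _ fk)).
rewrite mulrA -subr_ge0 -{2}[rip _ _]mul1r -mulrBl pmulr_lge0 // => le1.
have : e0 ^+ 2 <= e0 by rewrite expr2; nra.
move=> e2; have := ler_wpM2l C0 e2; move: e0E le1; nra.
Qed.

Lemma alg_spanned T : A T -> spanned T.
Proof.
move=> AT; case: hA => _ _ _ /(_ _ AT) [S [AS adj]] _.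
have adj' := is_adjoint_sym adj.
have sum (a : R[i]) : is_adjoint (fun x => conjc a *: T x + a *: S x)
    (fun x => conjc a *: T x + a *: S x).
  move=> x y; rewrite hinnerD !hinnerZ hinnerDr !hinnerZr conjcK adj adj'.
  by rewrite addrC.
have span (a : R[i]) : spanned (fun x => conjc a *: T x + a *: S x).
  by apply: spanned_sa => //; apply: alg_lin => //; exact: alg_scale.
pose i : R[i] := 'i%C.
have i2 : i * i = -1 by rewrite -expr2 sqr_i.
(* Cartesian decomposition: with [S] the adjoint, [a = 1] gives [T + S] and [a = i] gives
   [i (S - T)], both self-adjoint. *)
have := spanned_lin (2^-1 * i) (span i) (spanned_lin 2^-1 (span 1) spanned_zero).
suff -> : (fun x => 2^-1 * i *: (conjc i *: T x + i *: S x) +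
    (2^-1 *: (conjc 1 *: T x + 1 *: S x) + 0)) = T by [].
apply/funext => x; rewrite addr0 !scalerDr !scalerA -mulrA.
have -> : conjc i = - i by rewrite /i; simpc.
rewrite mulrN i2 opprK conjc1 -mulrA i2 mulrN mulr1 scaleNr addrACA addNr.
by rewrite addr0 -scalerDl -[2^-1]div1r -splitr scale1r.
Qed.

(** * Orthogonal refinement, prime filters and units *)

(** Additivity on orthogonal sums, stated by cutting [p] along an arbitrary [q], which is the form
    in which refinement uses it. *)
Definition splits (V : lmodType R[i]) (f : op H -> V) : Prop :=
  forall p q, P p -> P q -> f p = f (p \o q) + f (fun x => p x - p (q x)).

Definition orth p q : Prop := forall x, p (q x) = 0.

Definition orth_all p (l : seq (R[i] * op H)) : Prop :=
  foldr (fun j Q => orth p j.2 /\ Q) True l.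

Fixpoint orth_list (l : seq (R[i] * op H)) : Prop :=
  if l is j :: l' then orth_all j.2 l' /\ orth_list l' else True.

(** Venn-diagram refinement: each entry is cut along [p], the common part collects both
    coefficients, and the rest of [p] is passed on; what survives all entries is appended with
    coefficient [c]. *)
Fixpoint refine_insert (c : R[i]) p (l : seq (R[i] * op H)) :=
  if l is j :: l' then
    [:: (c + j.1, p \o j.2), (j.1, fun x => j.2 x - j.2 (p x))
      & refine_insert c (fun x => p x - p (j.2 x)) l']
  else [:: (c, p)].

Lemma refine_insert_projs c p l : P p -> all_projs l ->
  all_projs (refine_insert c p l).
Proof.
elim: l p => [|j l IH] p Pp //= [Pj Pl]; split; first exact: projs_comp.
by split; [exact: projs_diff | apply: IH => //; exact: projs_diff].
Qed.

Lemma refine_insert_comb (V : lmodType R[i]) (f : op H -> V) c p l :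
  splits f -> P p -> all_projs l ->
  comb f (refine_insert c p l) = c *: f p + comb f l.
Proof.
move=> sf; elim: l p => [|j l IH] p Pp /=; first by rewrite comb_cons.
move=> [Pj Pl]; rewrite !comb_cons IH //=; last exact: projs_diff.
rewrite (sf p j.2 Pp Pj) (sf j.2 p Pj Pp).
have -> : j.2 \o p = p \o j.2 by apply/funext => x /=; exact: projs_comm.
rewrite scalerDl !scalerDr -!addrA; congr (_ + _).
by rewrite [RHS]addrCA; congr (_ + _); rewrite addrCA.
Qed.

Lemma orth_refine_insert r c p l : P r -> P p -> all_projs l ->
  orth r p -> orth_all r l -> orth_all r (refine_insert c p l).
Proof.
move=> Pr; elim: l p => [|j l IH] p Pp //= [Pj Pl] rp [rj rl].
split; first by move=> x; exact: rp.
have Ar := projs_alg Pr.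
split; first by move=> x; rewrite (alg_opB Ar) !rj subrr.
apply: IH => //; first exact: projs_diff.
by move=> x; rewrite (alg_opB Ar) !rp subrr.
Qed.

Lemma refine_insert_orth c p l : P p -> all_projs l -> orth_list l ->
  orth_list (refine_insert c p l).
Proof.
elim: l p => [|j l IH] p Pp //= [Pj Pl] [ojl ol].
have Pd := projs_diff Pp Pj; have Pd' := projs_diff Pj Pp.
have Ap := projs_alg Pp; have Aj := projs_alg Pj.
have jp := projs_comm Pj Pp.
split; last first.
  split; last exact: IH.
  apply: orth_refine_insert => // [x|].
    by rewrite (alg_opB Ap) !(projsK Pp) subrr.
  move: ojl Pl; rewrite /orth_all; elim: (l) => //= k l' IHl [jk jl] [Pk Pl].
  split; last exact: IHl.
  by move=> x; rewrite jk -(projs_comm Pk Pp) jk subrr.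
split=> [x /=|].
  by rewrite (alg_opB Aj) !(projsK Pj) jp (alg_opB Ap) (projsK Pp) subrr.
apply: orth_refine_insert => // [||].
- exact: projs_comp.
- by move=> x /=; rewrite (alg_opB Aj) !jp !(projsK Pj) subrr (alg_op0 Ap).
- move: ojl; rewrite /orth_all; elim: (l) => //= k l' IHl [jk jl].
  by split; [move=> x /=; rewrite jk (alg_op0 Ap) | exact: IHl].
Qed.

(* The refined list works simultaneously for every [f] additive on orthogonal
   projections; this makes linear extensions from projections well defined. *)
Lemma orth_refinement l : all_projs l -> exists l', [/\ all_projs l',
  orth_list l' & forall (V : lmodType R[i]) (f : op H -> V), splits f ->
    comb f l' = comb f l].
Proof.
elim: l => [_|[c p] l IH /= [Pp /IH [l' [Pl' ol' e]]]]; first by exists [::].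
exists (refine_insert c p l'); split.
- exact: refine_insert_projs.
- exact: refine_insert_orth.
- by move=> V f sf; rewrite refine_insert_comb // e // comb_cons.
Qed.

Lemma splits_eval x : splits (@^~ x : op H -> hvec H).
Proof. by move=> p q _ _ /=; rewrite addrC subrK. Qed.

(** Applying the head projection to the relation kills the other terms, so each coefficient or its
    projection vanishes. *)
Lemma comb_orth_eq0 (V : lmodType R[i]) (f : op H -> V) l :
  f (fun=> 0) = 0 -> all_projs l -> orth_list l ->
  (forall x, comb (@^~ x) l = 0) -> comb f l = 0.
Proof.
move=> f0; elim: l => [|[c p] l IH] /=; first by rewrite comb_nil.
move=> [Pp Pl] [op ol] l0; have Ap := projs_alg Pp.
have cp x : c *: p x = 0.
  have := congr1 p (l0 x); rewrite comb_cons (alg_op0 Ap) (alg_opD Ap).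
  rewrite (alg_opZ Ap) (projsK Pp) => <-.
  suff -> : p (comb (@^~ x) l) = 0 by rewrite addr0.
  move: op; rewrite /orth_all; elim: (l) => [_|k l' IHl /= [pk pl]].
    by rewrite comb_nil (alg_op0 Ap).
  by rewrite comb_cons (alg_opD Ap) (alg_opZ Ap) pk IHl // scaler0 addr0.
rewrite comb_cons IH //=; last first.
  by move=> x; have := l0 x; rewrite comb_cons cp add0r.
have [->|c0] := eqVneq c 0; first by rewrite scale0r addr0.
suff -> : p = (fun=> 0) by rewrite f0 scaler0 addr0.
apply/funext => x; have /eqP := cp x.
by rewrite scaler_eq0 (negbTE c0) => /eqP.
Qed.

Lemma comb_ext (V : lmodType R[i]) (f : op H -> V) l l' :
  splits f -> f (fun=> 0) = 0 -> all_projs l -> all_projs l' ->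
  (forall x, comb (@^~ x) l = comb (@^~ x) l') -> comb f l = comb f l'.
Proof.
move=> sf f0 Pl Pl' e.
have [|m [Pm om mE]] := @orth_refinement (l ++ scale_list (-1) l').
  by apply: all_projs_cat => //; exact: all_projs_scale.
have : comb f m = 0.
  apply: comb_orth_eq0 => // x; rewrite (mE _ _ (splits_eval x)).
  by rewrite comb_cat comb_scale scaleN1r e subrr.
by rewrite mE // comb_cat comb_scale scaleN1r => /eqP; rewrite subr_eq0 => /eqP.
Qed.

(** Taking [q = p] in the difference clause excludes the zero projection. The empty family is
    allowed; it lies in none of the sets of the representation. *)
Definition prime_filter (F : op H -> Prop) : Prop :=
  forall p q, P p -> P q -> (F (p \o q) <-> F p /\ F q) /\
    (F (fun x => p x - p (q x)) <-> F p /\ ~ F q).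

(** The filter is the upward closure of a maximal multiplicative family [B] of nonzero projections
    containing [r]. Maximality decides every [p]: it lies above a member of [B] or is orthogonal to
    one. *)
Lemma prime_filter_exists r : P r -> r <> (fun=> 0) ->
  exists2 F, prime_filter F & F r.
Proof.
move=> Pr r0.
(* Membership of [r] is required only of nonempty families, so that the union of the empty chain
   qualifies. *)
pose base (B : set (op H)) :=
  (forall g, B g -> [/\ P g, g <> (fun=> 0) & B r]) /\
  (forall g h, B g -> B h -> B (g \o h)).
have [C Cbase Ctot|B [[B1 B2] Bmax]] := @Zorn_bigcup _ base.
  split=> [g [D CD Dg]|g h [D CD Dg] [D' CD' D'h]].
    by have [/(_ _ Dg) [? ? ?] _] := Cbase _ CD; split=> //; exists D.
  have [DD'|D'D] := Ctot _ _ CD CD'.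
    by exists D' => //; apply: (Cbase _ CD').2 => //; exact: DD'.
  by exists D => //; apply: (Cbase _ CD).2 => //; exact: D'D.
have Br : B r.
  apply: contrapT => nBr; have B0 g : ~ B g by move=> /B1 [].
  apply: (Bmax (fun g => g = r)).
    by split=> [g /B0 //|/(_ r erefl)].
  split=> [g -> //|g h -> ->]; apply/funext => x /=; exact: projsK.
have BP g : B g -> P g by move=> /B1 [].
have Bn0 g : B g -> ~ (forall x, g x = 0).
  by move=> /B1 [_ gn0 _] g0; apply: gn0; apply/funext.
pose F p := exists2 g, B g & forall x, g (p x) = g x.
have dich p : P p -> F p \/ exists2 g, B g & forall x, g (p x) = 0.
  move=> Pp; have [|nz] := pselect (exists2 g, B g & forall x, g (p x) = 0).
    by right.
  left; suff Brp : B (r \o p) by exists (r \o p) => // x /=; rewrite (projsK Pp).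
  apply: contrapT => nBrp.
  (* If [p] is orthogonal to no member, adjoining all products [g \o p] keeps the family
     admissible. *)
  pose B' : set (op H) := fun h => B h \/ exists2 g, B g & h = g \o p.
  apply: (Bmax B').
    by split=> [g ?|/(_ (r \o p)) BB]; [left | apply: nBrp; apply: BB; right; exists r].
  split=> [h [Bh|[g Bg ->]]|g h].
  - by have [? ? ?] := B1 _ Bh; split=> //; left.
  - split; first by apply: projs_comp => //; exact: BP.
      by move=> gp0; apply: nz; exists g => // x; exact: (congr1 (@^~ x) gp0).
    by left.
  - move=> [Bg|[g' Bg' ->]] [Bh|[h' Bh' ->]].
    + by left; exact: B2.
    + by right; exists (g \o h') => //; exact: B2.
    + right; exists (g' \o h); first exact: B2.
      by apply/funext => x /=; rewrite (projs_comm Pp (BP _ Bh)).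
    + right; exists (g' \o h'); first exact: B2.
      by apply/funext => x /=; rewrite (projs_comm Pp (BP _ Bh')) (projsK Pp).
exists F; last by exists r => // x; exact: projsK.
move=> p q Pp Pq; have Ap := projs_alg Pp; have pq := projs_comm Pp Pq.
split; split.
- move=> [g Bg gE]; split; exists g => // x; rewrite -[LHS]gE -[RHS]gE /=.
    by rewrite -pq (projsK Pp).
  by rewrite (projsK Pq).
- move=> [[g Bg gE] [h Bh hE]]; exists (g \o h); first exact: B2.
  have gh := projs_comm (BP _ Bg) (BP _ Bh).
  by move=> x /=; rewrite pq hE gh gE gh.
- move=> [g Bg gE]; have Ag := projs_alg (BP _ Bg); split.
    exists g => // x; rewrite -[LHS]gE -[RHS]gE.
    by rewrite -pq !(projsK Pp).
  move=> [h Bh hE]; apply: (Bn0 _ (B2 _ _ Bg Bh)) => x /=.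
  have Ah := projs_alg (BP _ Bh); have gh := projs_comm (BP _ Bg) (BP _ Bh).
  by rewrite gh -gE -gh (alg_opB Ah) pq hE subrr (alg_op0 Ag).
- move=> [[g Bg gE] nq]; have [//|[h Bh h0]] := dich _ Pq.
  exists (g \o h) => [|x /=]; first exact: B2.
  have Ag := projs_alg (BP _ Bg); have Ah := projs_alg (BP _ Bh).
  have gh := projs_comm (BP _ Bg) (BP _ Bh).
  by rewrite (alg_opB Ah) pq h0 subr0 gh gE gh.
Qed.

(** Stone's map: [p] goes to the prime filters containing it. When [p] is not below [q], a filter
    containing [p - p q] tells them apart. *)
Lemma projs_gen_boolean : is_gen_boolean P (@proj_le R H).
Proof.
pose f p : (op H -> Prop) -> Prop := fun F => prime_filter F /\ F p.
exists (op H -> Prop), (fun s => exists2 p, P p & s = f p).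
have meetE p q : P p -> P q -> f (p \o q) = fun F => f p F /\ f q F.
  move=> Pp Pq; apply/funext => F; apply/propext; split.
    by move=> [pF /(proj1 (proj1 (pF _ _ Pp Pq))) []].
  by move=> [[pF Fp] [_ Fq]]; split=> //; exact/(proj1 (pF _ _ Pp Pq)).
have diffE p q : P p -> P q ->
    f (fun x => p x - p (q x)) = fun F => f p F /\ ~ f q F.
  move=> Pp Pq; apply/funext => F; apply/propext; split.
    by move=> [pF /(proj1 (proj2 (pF _ _ Pp Pq))) [Fp nFq]]; split=> // -[].
  move=> [[pF Fp] nFq]; split=> //; apply/(proj2 (pF _ _ Pp Pq)).
  by split=> // Fq; exact: nFq.
have incl p q : P p -> P q -> set_incl (f p) (f q) -> p \o q = p.
  move=> Pp Pq pq; apply: contrapT => npq.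
  have [||F pF Fd] := @prime_filter_exists (fun x => p x - p (q x)).
  - exact: projs_diff.
  - move=> d0; apply: npq; apply/funext => x /=.
    by apply/esym/eqP; rewrite -subr_eq0; apply/eqP; exact: (congr1 (@^~ x) d0).
  - have : f (fun x => p x - p (q x)) F by split.
    by rewrite (diffE p q Pp Pq) => -[/pq fq []].
split; last exists f; first split.
- by exists (f (fun=> 0)), (fun=> 0) => //; exact: projs_zero.
- move=> _ _ [p Pp ->] [q Pq ->]; split.
  + by exists (p \o q); [exact: projs_comp | rewrite (meetE p q)].
  + have Ap := projs_alg Pp; have Aq := projs_alg Pq; have pq := projs_comm Pp Pq.
    (* The join of [p] and [q]. The filter axioms have no clause for joins; the union is recovered
       from [p = j p], [q = j q] and [j - j p = q - q p]. *)
    pose j x := p x + (q x - q (p x)).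
    have Pj : P j.
      apply: projs_orth_add => //; first exact: projs_diff.
      by move=> x; rewrite (alg_opB Ap) -!pq (projsK Pp) subrr.
    exists j => //; apply/funext => F; apply/propext.
    have -> : f p = f (j \o p).
      congr f; apply/funext => x; rewrite /j /= !(projsK Pp).
      by rewrite subrr addr0.
    have -> : f q = f (j \o q).
      congr f; apply/funext => x; rewrite /j /= -pq !(projsK Pq).
      by rewrite addrC subrK.
    rewrite (meetE j p Pj Pp) (meetE j q Pj Pq); split=> [[[? _]|[? _]] //|fj].
    have [?|nfp] := pselect (f p F); [by left | right; split=> //].
    have : f (fun x => j x - j (p x)) F by rewrite (diffE j p Pj Pp).
    have -> : (fun x => j x - j (p x)) = fun x => q x - q (p x).
      by apply/funext => x; rewrite /j !(projsK Pp) subrr addr0 addrC addKr.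
    by rewrite (diffE q p Pq Pp) => -[].
  + by exists (fun x => p x - p (q x)); [exact: projs_diff | rewrite (diffE p q)].
split=> [p Pp|p q Pp Pq e|_ [p Pp ->]|p q Pp Pq].
- by exists p.
- have pq : p \o q = p by apply: incl => // F; rewrite e.
  have qp : q \o p = q by apply: incl => // F; rewrite e.
  by rewrite -[LHS]pq -[RHS]qp; apply/funext => x; exact: (projs_comm Pp Pq).
- by exists p.
- split=> [e F|]; last exact: incl.
  by rewrite -[p in f p]e (meetE p q Pp Pq) => -[].
Qed.

(** A unit is idempotent, hence the largest projection; conversely a largest projection fixes all
    projections and so their span, which is [A]. *)
Lemma unital_top : unital_alg A <->
  exists2 e, P e & forall p, P p -> proj_le p e.
Proof.
split=> [[e [Ae eE]]|[e Pe eE]].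
  exists e => [|p [Ap _]]; last by have [] := eE _ Ap.
  by apply: projs_idem => // x; have [h _] := eE _ Ae; exact: (congr1 (@^~ x) h).
have Ae := projs_alg Pe; exists e; split=> // T AT.
suff Te : T \o e = T by rewrite (cA Ae AT).
have [l Pl ->] := alg_spanned AT; apply/funext => x /=.
elim: l Pl => [_|[c p] l IH /= [Pp Pl]]; first by rewrite !comb_nil.
by rewrite !comb_cons IH //=; congr (_ *: _ + _); exact: (congr1 (@^~ x) (eE _ Pp)).
Qed.

End CommutativeRstar.

(** * Order isomorphisms and *-isomorphisms *)

Section OrderIso.
Variables (T U : Type) (D : T -> Prop) (le : T -> T -> Prop).
Variables (E : U -> Prop) (le' : U -> U -> Prop).

(** The point [x0] is only the value of the inverse outside [E]. *)
Lemma order_iso_inverse (x0 : T) : order_iso D le E le' ->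
  exists f g, [/\ forall x, D x -> E (f x), forall z, E z -> D (g z),
    forall x, D x -> g (f x) = x, forall z, E z -> f (g z) = z &
    (forall x y, D x -> D y -> le x y <-> le' (f x) (f y)) /\
    (forall z w, E z -> E w -> le' z w <-> le (g z) (g w))].
Proof.
move=> [f [fE fI fS fM]].
have [z|g gP] := @choice _ _ (fun z x => E z -> D x /\ f x = z).
  have [/fS [x [? ?]]|nEz] := pselect (E z); first by exists x.
  by exists x0.
exists f, g; split=> // [z /gP []//|x Dx|z /gP []//|].
  by have [Dg fg] := gP _ (fE _ Dx); exact: fI.
split=> // z w Ez Ew; have [Dz fz] := gP _ Ez; have [Dw fw] := gP _ Ew.
by rewrite fM // fz fw.
Qed.

Lemma order_iso_trans (V : Type) (F : V -> Prop) (le'' : V -> V -> Prop) :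
  order_iso D le E le' -> order_iso E le' F le'' -> order_iso D le F le''.
Proof.
move=> [f [fE fI fS fM]] [g [gE gI gS gM]]; exists (g \o f).
split=> [x /fE/gE //|x y Dx Dy /= e|z /gS [y [/fS [x [Dx <-]] <-]]|x y Dx Dy].
- by apply: fI => //; apply: gI => //; exact: fE.
- by exists x.
- by rewrite fM // gM //; exact: fE.
Qed.

(** The ambient set may be larger than the image of the top, so complements can leave the family.
    Restricting every set to the points of [f e] loses nothing, as all images are contained in
    it. *)
Lemma is_boolean_top (e : T) : is_gen_boolean D le -> D e ->
  (forall x, D x -> le x e) -> is_boolean D le.
Proof.
move=> [X [S [[_ SP] [f [fS fI fsurj fM]]]]] De top.
pose res s : {x | f e x} -> Prop := fun x => s (sval x).
have incl s t : S s -> S t -> set_incl (res s) (res t) -> set_incl s t.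
  move=> /fsurj [x [Dx <-]] /fsurj [y [Dy <-]] st u xu.
  have eu : f e u by have /(fM _ _ Dx De) := top _ Dx; apply.
  exact: (st (exist _ u eu)).
exists {x | f e x}, (fun s => exists2 t, S t & s = res t); split.
  split=> [|_ _ [s Ss ->] [t St ->]|_ _ [s Ss ->] [t St ->]|_ [s Ss ->]].
  - by exists (res (f e)), (f e) => //; exact: fS.
  - by exists (fun x => s x /\ t x) => //; have [] := SP _ _ Ss St.
  - by exists (fun x => s x \/ t x) => //; have [] := SP _ _ Ss St.
  - exists (fun x => f e x /\ ~ s x); first by have [] := SP _ _ (fS _ De) Ss.
    by apply/funext => -[x ex]; apply/propext; split=> // -[].
exists (res \o f); split=> [x Dx|x y Dx Dy /= xy|_ [_ /fsurj [x [Dx <-]] ->]|x y Dx Dy].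
- by exists (f x) => //; exact: fS.
- apply: fI => //; apply/funext => u; apply/propext.
  by split; apply: incl u; rewrite ?xy //; exact: fS.
- by exists x.
- rewrite fM //; split; first by move=> xy u; exact: xy.
  by apply: incl; exact: fS.
Qed.

Lemma boolean_has_top : is_boolean D le ->
  exists2 e, D e & forall x, D x -> le x e.
Proof.
move=> [X [S [[[s Ss] _ SU SC] [f [fS fI fsurj fM]]]]].
have [e [De fe]] := fsurj _ (SU _ _ Ss (SC _ Ss)).
exists e => // x Dx; rewrite fM // fe => u _.
by have [?|?] := pselect (s u); [left|right].
Qed.

End OrderIso.

Section StarIsoOrderIso.
Variables (R : realType) (H1 H2 : hilbert R).
Variables (A : op H1 -> Prop) (B : op H2 -> Prop).
Hypotheses (hA : Rstar_alg A) (cA : commutative_alg A).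
Hypotheses (hB : Rstar_alg B) (cB : commutative_alg B).

Lemma star_iso_projs : star_iso A B ->
  order_iso (projs A) (@proj_le R H1) (projs B) (@proj_le R H2).
Proof.
move=> [phi [pB pI [pS plin] pM pA]]; exists phi; split.
- move=> p [Ap [pp sp]]; split; first exact: pB.
  by rewrite -(pM p p Ap Ap) pp; split=> //; exact: pA.
- by move=> p q [Ap _] [Aq _]; exact: pI.
- move=> U [/pS [T [AT <-]] [UU aU]]; exists T; split=> //.
  split=> //; split; first by apply: pI; rewrite ?(pM T T AT AT) //; exact: (alg_comp hA).
  case: hA => _ _ _ /(_ _ AT) [S [AS a]] _.
  (* Uniqueness of adjoints in [B] together with injectivity shows that the preimage of a
     self-adjoint element is self-adjoint. *)
  have e : phi S = phi T by apply: is_adjoint_inj aU; exact: pA.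
  by move: a; rewrite (pI _ _ AS AT e).
- move=> p q [Ap _] [Aq _]; rewrite /proj_le -(pM p q Ap Aq); split=> [-> //|].
  by apply: pI => //; exact: (alg_comp hA).
Qed.

(** Products are meets, so they are preserved. For the splitting, the sum of the images of [p q] and
    [p - p q] is a projection, which is compared with [f p] in both directions. *)
Lemma order_iso_splits (f : op H1 -> op H2) (g : op H2 -> op H1) :
  (forall p, projs A p -> projs B (f p)) ->
  (forall q, projs B q -> projs A (g q)) ->
  (forall q, projs B q -> f (g q) = q) ->
  (forall p q, projs A p -> projs A q -> proj_le p q <-> proj_le (f p) (f q)) ->
  [/\ f (fun=> 0) = (fun=> 0),
      (forall p q, projs A p -> projs A q -> f (p \o q) = f p \o f q) &
      forall y, splits A (fun p => f p y)].
Proof.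
move=> fB gA fg fM; have P0 := projs_zero hA cA.
have f0 : f (fun=> 0) = (fun=> 0).
  have Q0 := projs_zero hB cB.
  have /fM : proj_le (fun=> 0) (g (fun=> 0)) by [].
  move=> /(_ P0 (gA _ Q0)); rewrite fg // /proj_le => <-.
  by apply/funext => x /=; rewrite (alg_op0 hB) //; exact: (projs_alg (fB _ P0)).
have fcomp p q : projs A p -> projs A q -> f (p \o q) = f p \o f q.
  move=> Pp Pq; have Ppq := projs_comp hA cA Pp Pq.
  have [Qp Qq Qpq] := And3 (fB _ Pp) (fB _ Pq) (fB _ Ppq).
  have Qr := projs_comp hB cB Qp Qq.
  have le1 : proj_le (f (p \o q)) (f p).
    apply/fM => //; apply/funext => x /=.
    by rewrite -(projs_comm cA Pp Pq) (projsK Pp).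
  have le2 : proj_le (f (p \o q)) (f q).
    by apply/fM => //; apply/funext => x /=; rewrite (projsK Pq).
  have le3 : proj_le (f p \o f q) (f (p \o q)).
    rewrite -(fg _ Qr); apply/fM => //; first exact: gA.
    have ge1 : proj_le (g (f p \o f q)) p.
      apply/fM => //; first exact: gA.
      rewrite fg //; apply/funext => x /=.
      by rewrite -(projs_comm cB Qp Qq) (projsK Qp).
    have ge2 : proj_le (g (f p \o f q)) q.
      apply/fM => //; first exact: gA.
      by rewrite fg //; apply/funext => x /=; rewrite (projsK Qq).
    by rewrite /proj_le compA ge1.
  apply/funext => x; have /= <- := congr1 (@^~ x) le3.
  rewrite -(projs_comm cB Qpq Qq) -(projs_comm cB Qpq Qp).
  have /= -> := congr1 (@^~ (f q x)) le1.
  by have /= -> := congr1 (@^~ x) le2.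
split=> // y p q Pp Pq.
have Pa := projs_comp hA cA Pp Pq; have Pb := projs_diff hA cA Pp Pq.
set a := p \o q in Pa *; set b := (fun x => p x - p (q x)) in Pb *.
have Ap := projs_alg Pp; have Aq := projs_alg Pq.
have pq := projs_comm cA Pp Pq.
have ab0 : a \o b = (fun=> 0).
  apply/funext => x; rewrite /a /b /= (alg_opB hA Aq) -!pq (projsK Pq) subrr.
  exact: alg_op0 hA _ Ap.
have Qa := fB _ Pa; have Qb := fB _ Pb; have Qp := fB _ Pp.
have Qs : projs B (fun x => f a x + f b x).
  apply: projs_orth_add => // x.
  by have := congr1 (@^~ x) (fcomp _ _ Pa Pb); rewrite ab0 f0.
set s := (fun x => f a x + f b x) in Qs *.
have Bs := projs_alg Qs.
have ap : f a \o f p = f a.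
  rewrite -fcomp //; congr f; apply/funext => x; rewrite /a /=.
  by rewrite -pq (projsK Pp).
have bp : f b \o f p = f b.
  rewrite -fcomp //; congr f; apply/funext => x; rewrite /b /=.
  by rewrite -pq !(projsK Pp).
have ba0 x : f b (f a x) = 0.
  rewrite -(projs_comm cB Qa Qb).
  by have := congr1 (@^~ x) (fcomp _ _ Pa Pb); rewrite ab0 f0.
have sp : s \o f p = s.
  apply/funext => x; rewrite /s /=.
  by congr (_ + _); [exact: (congr1 (@^~ x) ap) | exact: (congr1 (@^~ x) bp)].
(* Pulled back by [g], [s] dominates both pieces of [p], hence their sum [p]. *)
have ps : proj_le (f p) s.
  rewrite -(fg _ Qs); apply/fM => //; first exact: gA.
  have as_ : a \o g s = a.
    apply/fM => //; first exact: gA.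
    rewrite fg //; apply/funext => x; rewrite /= (projs_comm cB Qa Qs) /s.
    by rewrite (projsK Qa) ba0 addr0.
  have bs_ : b \o g s = b.
    apply/fM => //; first exact: gA.
    rewrite fg //; apply/funext => x; rewrite /= (projs_comm cB Qb Qs) /s.
    by rewrite (projsK Qb) (projs_comm cB Qa Qb) ba0 add0r.
  have pE : p = fun x => a x + b x.
    by apply/funext => x; rewrite /a /b /= addrC subrK.
  apply/funext => x; rewrite [LHS](congr1 (@^~ (g s x)) pE) [RHS](congr1 (@^~ x) pE).
  by congr (_ + _); [exact: (congr1 (@^~ x) as_) | exact: (congr1 (@^~ x) bs_)].
suff -> : f p = s by [].
by rewrite -[LHS]ps -[RHS]sp; apply/funext => x; exact: (projs_comm cB Qp Qs).
Qed.

End StarIsoOrderIso.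

Section Extension.
Variables (R : realType) (H1 H2 : hilbert R).
Variables (A : op H1 -> Prop) (B : op H2 -> Prop).
Hypotheses (hA : Rstar_alg A) (cA : commutative_alg A).
Hypotheses (hB : Rstar_alg B) (cB : commutative_alg B).

(** The graph of the linear extension of [f]. As a relation it lets each algebraic law be proved
    with any convenient list before a function is chosen. *)
Definition comb_rel (f : op H1 -> op H2) (T : op H1) (U : op H2) : Prop :=
  exists2 l, all_projs A l &
    (forall x, T x = comb (@^~ x) l) /\ (forall y, U y = comb (fun p => f p y) l).

Definition map_list (K L : hilbert R) (f : op K -> op L)
  (l : seq (R[i] * op K)) : seq (R[i] * op L) := [seq (j.1, f j.2) | j <- l].

Lemma comb_map_list (K L : hilbert R) (f : op K -> op L) (V : lmodType R[i])
  (h : op L -> V) l : comb h (map_list f l) = comb (h \o f) l.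
Proof. by rewrite /comb big_map. Qed.

Lemma all_projs_map (K L : hilbert R) (C : op K -> Prop) (C' : op L -> Prop)
  (f : op K -> op L) l : (forall p, projs C p -> projs C' (f p)) ->
  all_projs C l -> all_projs C' (map_list f l).
Proof. by move=> fP; elim: l => //= j l IH [/fP ? /IH]. Qed.

Lemma eq_comb (K : hilbert R) (C : op K -> Prop) (V : lmodType R[i])
  (h h' : op K -> V) l : (forall p, projs C p -> h p = h' p) ->
  all_projs C l -> comb h l = comb h' l.
Proof.
move=> hh; elim: l => [|j l IH /= [/hh e /IH {}IH]]; first by rewrite !comb_nil.
by rewrite !comb_cons e IH.
Qed.

Lemma order_iso_star :
  order_iso (projs A) (@proj_le R H1) (projs B) (@proj_le R H2) -> star_iso A B.
Proof.
move=> /(order_iso_inverse (fun=> 0)) [f [g [fB gA gf fg [fM gM]]]].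
have [f0 fcomp fsplit] := order_iso_splits hA cA hB cB fB gA fg fM.
have [g0 _ gsplit] := order_iso_splits hB cB hA cA gA fB gf gM.
have f0y y : f (fun=> 0) y = 0 by rewrite f0.
have g0y y : g (fun=> 0) y = 0 by rewrite g0.
have rel_fun T U U' : comb_rel f T U -> comb_rel f T U' -> U = U'.
  move=> [l Pl [TE UE]] [l' Pl' [TE' UE']]; apply/funext => y.
  rewrite UE UE'; apply: (comb_ext hA cA (fsplit y) (f0y y) Pl Pl') => x.
  by rewrite -TE -TE'.
(* Single-valuedness for [g], applied to the image lists: evaluating them through [g] gives back the
   original combinations. *)
have rel_inj S T U : comb_rel f S U -> comb_rel f T U -> S = T.
  move=> [l Pl [TE UE]] [l' Pl' [TE' UE']]; apply/funext => x.
  have Ql := all_projs_map fB Pl; have Ql' := all_projs_map fB Pl'.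
  have e k : all_projs A k -> comb (fun q => g q x) (map_list f k) = comb (@^~ x) k.
    move=> Pk; rewrite comb_map_list; apply: (eq_comb _ Pk) => p Pp /=.
    by rewrite gf.
  rewrite TE TE' -(e _ Pl) -(e _ Pl').
  apply: (comb_ext hB cB (gsplit x) (g0y x) Ql Ql') => y.
  by rewrite !comb_map_list -[LHS]UE -[RHS]UE'.
have rel_lin a S T U V : comb_rel f S U -> comb_rel f T V ->
    comb_rel f (fun x => a *: S x + T x) (fun y => a *: U y + V y).
  move=> [l Pl [TE UE]] [l' Pl' [TE' UE']]; exists (scale_list a l ++ l').
    by apply: all_projs_cat => //; exact: all_projs_scale.
  by split=> x; rewrite comb_cat comb_scale ?TE ?TE' ?UE ?UE'.
have rel_B T U : comb_rel f T U -> B U.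
  move=> [l Pl [_ UE]]; have -> : U = fun y => comb (@^~ y) (map_list f l).
    by apply/funext => y; rewrite comb_map_list UE.
  exact: (alg_comb hB (all_projs_map fB Pl)).
have rel_proj p T U : projs A p -> comb_rel f T U ->
    comb_rel f (p \o T) (f p \o U).
  move=> Pp [l Pl [TE UE]]; exists (map_list (comp p) l).
    by apply: all_projs_map Pl => q; exact: (projs_comp hA cA Pp).
  have Ap := projs_alg Pp; have Bp := projs_alg (fB _ Pp).
  split=> x /=; rewrite comb_map_list ?TE ?UE {TE UE}.
    elim: l {Pl} => [|j l IH]; first by rewrite !comb_nil (alg_op0 hA Ap).
    by rewrite !comb_cons (alg_opD hA Ap) (alg_opZ hA Ap) IH.
  elim: l Pl => [|j l IH /= [Pj Pl]]; first by rewrite !comb_nil (alg_op0 hB Bp).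
  rewrite !comb_cons (alg_opD hB Bp) (alg_opZ hB Bp) IH //=.
  by rewrite (fcomp _ _ Pp Pj).
have rel_zero : comb_rel f (fun=> 0) (fun=> 0).
  by exists [::] => //; split=> x; rewrite comb_nil.
have rel_comp S T U V : comb_rel f S U -> comb_rel f T V ->
    comb_rel f (S \o T) (U \o V).
  move=> [l Pl [SE UE]] TV.
  have -> : S = fun x => comb (@^~ x) l by apply/funext.
  have -> : U = fun y => comb (fun p => f p y) l by apply/funext.
  elim: l Pl {SE UE} => [_|[a p] l IH /= [Pp /IH {}IH]].
    suff [-> ->] : ((fun x => comb (@^~ x) [::]) \o T = fun=> 0) /\
      ((fun y => comb (fun p => f p y) [::]) \o V = fun=> 0) by [].
    by split; apply/funext => x /=; rewrite comb_nil.
  have := rel_lin a _ _ _ _ (rel_proj _ _ _ Pp TV) IH.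
  by congr comb_rel; apply/funext => x /=; rewrite comb_cons.
(* Conjugating the coefficients gives adjoints on both sides at once, since each [p] and [f p] is
   self-adjoint. *)
have rel_adj T U : comb_rel f T U -> exists S V,
    [/\ comb_rel f S V, is_adjoint T S & is_adjoint U V].
  move=> [l Pl [TE UE]].
  have -> : T = fun x => comb (@^~ x) l by apply/funext.
  have -> : U = fun y => comb (fun p => f p y) l by apply/funext.
  elim: l Pl {TE UE} => [_|[a p] l IH /= [Pp /IH [S [V [SV aS aV]]]]].
    exists (fun=> 0), (fun=> 0); split=> // x y; rewrite comb_nil;
      by rewrite hinner0 hinner0r.
  have [_ [_ ap]] := Pp; have [_ [_ aq]] := fB _ Pp.
  exists (fun x => conjc a *: p x + S x), (fun y => conjc a *: f p y + V y); split.
  - apply: rel_lin => //; exists [:: (1, p)] => //=.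
    by split=> x; rewrite comb_cons comb_nil addr0 scale1r.
  - have := is_adjoint_lin a ap aS; congr is_adjoint.
    by apply/funext => x; rewrite comb_cons.
  - have := is_adjoint_lin a aq aV; congr is_adjoint.
    by apply/funext => x; rewrite comb_cons.
have [T|phi phiP] := @choice _ _ (fun T U => A T -> comb_rel f T U).
  have [/(alg_spanned hA cA) [l Pl ->]|nAT] := pselect (A T); last by exists (fun=> 0).
  by exists (fun y => comb (fun p => f p y) l) => _; exists l.
have phiE T U : A T -> comb_rel f T U -> phi T = U.
  by move=> /phiP TU; exact: rel_fun.
exists phi; split.
- by move=> T /phiP /rel_B.
- by move=> S T /phiP SU /phiP TU e; apply: rel_inj TU; rewrite -e.
- split=> [U BU|a S T AS AT].
    have [l Pl ->] := alg_spanned hB cB BU.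
    have Ql := all_projs_map gA Pl.
    exists (fun x => comb (@^~ x) (map_list g l)); have Al := alg_comb hA Ql.
    split=> //; apply: phiE => //; exists (map_list g l) => //; split=> // y.
    rewrite comb_map_list; apply: (eq_comb _ Pl) => q Pq /=.
    by rewrite fg.
  apply: phiE; first exact: alg_lin.
  by apply: rel_lin; exact: phiP.
- move=> S T AS AT; apply: phiE; first exact: alg_comp.
  by apply: rel_comp; exact: phiP.
- move=> T S AT AS aTS.
  have [S' [V [SV aS aV]]] := rel_adj _ _ (phiP _ AT).
  by move: SV; rewrite -(is_adjoint_inj aTS aS) => /(phiE _ _ AS) ->.
Qed.

End Extension.

(** * The Hilbert space l2(X) *)

Section SquaredModulus.
Variable R : realType.
Implicit Types z w : R[i].

Definition sqn z : R := complex.Re z ^+ 2 + complex.Im z ^+ 2.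

Lemma sqn_ge0 z : 0 <= sqn z.
Proof. by rewrite addr_ge0 ?sqr_ge0. Qed.

Lemma sqn0 : sqn 0 = 0.
Proof. by rewrite /sqn /= expr0n addr0. Qed.

Lemma sqn_eq0 z : sqn z = 0 -> z = 0.
Proof.
case: z => a b; rewrite /sqn /= => /eqP.
by rewrite paddr_eq0 ?sqr_ge0 // !expf_eq0 /= => /andP[/eqP -> /eqP ->].
Qed.

Lemma sqnM z w : sqn (z * w) = sqn z * sqn w.
Proof. by case: z w => a b [c d]; rewrite /sqn /=; ring. Qed.

Lemma sqnN z : sqn (- z) = sqn z.
Proof. by case: z => a b; rewrite /sqn /= !sqrrN. Qed.

Lemma sqnJ z : sqn (conjc z) = sqn z.
Proof. by case: z => a b; rewrite /sqn /= sqrrN. Qed.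

Lemma sqnD_le z w : sqn (z + w) <= 2 * sqn z + 2 * sqn w.
Proof.
case: z w => a b [c d]; rewrite /sqn /=.
by have := sqr_ge0 (a - c); have := sqr_ge0 (b - d); nra.
Qed.

Lemma sqnB_le z w : sqn (z - w) <= 2 * sqn z + 2 * sqn w.
Proof. by have := sqnD_le z (- w); rewrite sqnN. Qed.

Lemma mulJ_sqn z : z * conjc z = (sqn z)%:C.
Proof. by case: z => a b; rewrite /sqn; simpc; congr (_ +i* _); ring. Qed.

Lemma sqn_small z w : (forall e : R, 0 < e -> sqn (z - w) <= e) -> z = w.
Proof.
move=> h; apply/eqP; rewrite -subr_eq0; apply/eqP/sqn_eq0/eqP.
by rewrite eq_le sqn_ge0 andbT; apply/ler_addgt0Pl => e /h; rewrite addr0.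
Qed.

End SquaredModulus.

Section Summation.
Variables (R : realType) (X : choiceType).
Implicit Types (F G : {fset X}) (h k : X -> R[i]).

Lemma sum_fset_le (g : X -> R) F G : (forall x, 0 <= g x) ->
  (F `<=` G)%fset -> \sum_(x <- F) g x <= \sum_(x <- G) g x.
Proof.
move=> g0 /fsubsetP FG.
have -> : \sum_(x <- F) g x = \sum_(x <- G | x \in F) g x.
  rewrite -[RHS]big_filter; apply/perm_big/uniq_perm.
  - exact: fset_uniq.
  - by rewrite filter_uniq // fset_uniq.
  - move=> x; rewrite mem_filter; apply/idP/andP => [xF|[] //].
    by split=> //; exact: FG.
by rewrite big_mkcond; apply: ler_sum => x _; case: ifP.
Qed.

(** Unconditional summation along the net of finite subsets, with distances measured by the squared
    modulus. *)
Definition has_sum h (l : R[i]) : Prop := forall e : R, 0 < e ->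
  exists F, forall G, (F `<=` G)%fset -> sqn (\sum_(x <- G) h x - l) < e.

Lemma has_sum_lin a h k l m : has_sum h l -> has_sum k m ->
  has_sum (fun x => a * h x + k x) (a * l + m).
Proof.
move=> hl km e e0; pose d := e / (4 * (sqn a + 1)).
have a0 := sqn_ge0 a.
have d0 : 0 < d by rewrite divr_gt0 //; lra.
have e4 : 0 < e / 4 by rewrite divr_gt0 //; lra.
have [F hF] := hl _ d0; have [F' hF'] := km _ e4.
exists (F `|` F')%fset => G; rewrite fsubUset => /andP[/hF h1 /hF' h2].
rewrite big_split -mulr_sumr /= opprD addrACA -mulrBr.
apply: (le_lt_trans (sqnD_le _ _)); rewrite sqnM.
have : sqn a * sqn (\sum_(x <- G) h x - l) <= sqn a * d by rewrite ler_wpM2l // ltW.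
have : d * (4 * (sqn a + 1)) = e by rewrite divfK //; lra.
nra.
Qed.

Lemma has_sum_unique h l m : has_sum h l -> has_sum h m -> l = m.
Proof.
move=> hl hm; apply: sqn_small => e e0.
have e4 : 0 < e / 4 by rewrite divr_gt0 //; lra.
have [F hF] := hl _ e4; have [F' hF'] := hm _ e4.
have h1 := hF _ (fsubsetUl F F'); have h2 := hF' _ (fsubsetUr F F').
move: (\sum_(x <- _) _) h1 h2 => s h1 h2.
have -> : l - m = (s - m) - (s - l) by rewrite opprB [RHS]addrC addrA subrK.
by apply: (le_trans (sqnB_le _ _)); lra.
Qed.

Lemma has_sum_conj h l : has_sum h l -> has_sum (fun x => conjc (h x)) (conjc l).
Proof.
move=> hl e /hl [F hF]; exists F => G /hF.
by rewrite -rmorph_sum /= -rmorphB /= sqnJ.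
Qed.

Lemma has_sum_nonneg (g : X -> R) (M : R) : (forall x, 0 <= g x) ->
  (forall F, \sum_(x <- F) g x <= M) ->
  exists2 s : R, has_sum (fun x => (g x)%:C) s%:C &
    (forall F, \sum_(x <- F) g x <= s) /\
    (forall N, (forall F, \sum_(x <- F) g x <= N) -> s <= N).
Proof.
move=> g0 gM; pose E : set R := fun t => exists F, t = \sum_(x <- F) g x.
have supE : has_sup E.
  by split; [exists 0, fset0; rewrite big_nil | exists M => _ [F ->]].
have ub F : \sum_(x <- F) g x <= sup E.
  by apply: (sup_upper_bound supE); exists F.
exists (sup E); last first.
  by split=> // N gN; apply: ge_sup => [|_ [F ->] //]; exact: supE.1.
(* The cap at 1 makes a gap below [d] have square below [e]. *)
move=> e e0; pose d := Num.min 1 e.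
have d0 : 0 < d by rewrite lt_min ltr01.
have [_ [F ->] hF] := sup_adherent d0 supE; exists F => G FG.
rewrite -rmorph_sum /= -rmorphB /= /sqn /= expr0n addr0.
have := ub G; have := sum_fset_le g0 FG; have d1 : d <= 1 by rewrite ge_min lexx.
have de : d <= e by rewrite ge_min lexx orbT.
move: (sup E) (\sum_(x <- F) _) (\sum_(x <- G) _) hF => s a b h1 h2 h3.
nra.
Qed.

Definition l2 (f : X -> R[i]) : Prop :=
  exists M, forall F, \sum_(x <- F) sqn (f x) <= M.

Lemma l2_lin a f g : l2 f -> l2 g -> l2 (fun x => a * f x + g x).
Proof.
move=> [M hM] [N hN]; exists (2 * sqn a * M + 2 * N) => F.
have := hM F; have := hN F; have a0 := sqn_ge0 a => h1 h2.
apply: (@le_trans _ _ (\sum_(x <- F) (2 * sqn a * sqn (f x) + 2 * sqn (g x)))).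
  by apply: ler_sum => x _; rewrite -mulrA -sqnM sqnD_le.
rewrite big_split -!mulr_sumr /=.
by apply: lerD; apply: ler_wpM2l => //; lra.
Qed.

Lemma l2_bounded_mul (M : R) g f : (forall x, sqn (g x) <= M) -> l2 f ->
  l2 (fun x => g x * f x).
Proof.
move=> gM [N hN]; exists (`|M| * N) => F.
apply: (@le_trans _ _ (\sum_(x <- F) (`|M| * sqn (f x)))).
  apply: ler_sum => x _; rewrite sqnM ler_wpM2r ?sqn_ge0 //.
  exact: le_trans (gM x) (ler_norm _).
by rewrite -mulr_sumr ler_wpM2l.
Qed.

Lemma polarization (z w : R[i]) : z * conjc w =
  (4^-1)%:C * ((sqn (1 * w + z))%:C - (sqn (-1 * w + z))%:C
    + 'i%C * (sqn ('i%C * w + z))%:C - 'i%C * (sqn (- 'i%C * w + z))%:C).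
Proof.
case: z w => a b [c d]; rewrite /sqn; simpc => /=.
by simpc; congr (_ +i* _); field.
Qed.

(** Polarization writes the terms through four families of squared moduli, each summable because its
    finite sums are bounded. *)
Lemma l2_inner_sum f g : l2 f -> l2 g ->
  exists l, has_sum (fun x => f x * conjc (g x)) l.
Proof.
move=> lf lg.
have sq a : exists l, has_sum (fun x => (sqn (a * g x + f x))%:C) l.
  have [M hM] := l2_lin a lg lf.
  have [s hs _] := has_sum_nonneg (fun x => sqn_ge0 (a * g x + f x)) hM.
  by exists s%:C.
have z0 : has_sum (fun=> 0) 0.
  move=> e e0; exists fset0 => G _; rewrite big1 // subrr sqn0 //.
have [a h1] := sq 1; have [b h2] := sq (-1).
have [c h3] := sq 'i%C; have [d h4] := sq (- 'i%C).
have := has_sum_lin (4^-1)%:C h1 z0.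
move=> /(has_sum_lin (- (4^-1)%:C) h2) /(has_sum_lin ((4^-1)%:C * 'i%C) h3).
move=> /(has_sum_lin (- ((4^-1)%:C * 'i%C)) h4).
set l := (X in has_sum _ X) => hl; exists l; move: hl; congr has_sum.
by apply/funext => x; rewrite polarization; ring.
Qed.

End Summation.

Section L2Space.
Variables (R : realType) (X : choiceType).

Definition l2_pred : {pred X -> R[i]} := fun f => `[< l2 f >].

Lemma l2_predP f : reflect (l2 f) (f \in l2_pred).
Proof. exact: asboolP. Qed.

Lemma l2_submod_closed : submod_closed l2_pred.
Proof.
split=> [|a f g /l2_predP lf /l2_predP lg].
  by apply/l2_predP; exists 0 => F; rewrite big1 // => x _; exact: sqn0.
by apply/l2_predP; exact: l2_lin.
Qed.

HB.instance Definition _ :=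
  GRing.isSubmodClosed.Build R[i] (X -> R[i]) l2_pred l2_submod_closed.

Record l2space := L2Space { l2val : X -> R[i]; _ : l2val \in l2_pred }.

HB.instance Definition _ := [isSub for l2val].
HB.instance Definition _ := [Choice of l2space by <:].
HB.instance Definition _ := [SubChoice_isSubLmodule of l2space by <:].

Implicit Types f g h : l2space.

Lemma l2valP f : l2 (l2val f).
Proof. by case: f => f /= /l2_predP. Qed.

Lemma l2val_lin a f g x :
  l2val (a *: f + g) x = a * l2val f x + l2val g x.
Proof. by []. Qed.

Definition l2_inner f g : R[i] :=
  xget 0 (has_sum (fun x => l2val f x * conjc (l2val g x))).

Lemma l2_innerP f g :
  has_sum (fun x => l2val f x * conjc (l2val g x)) (l2_inner f g).
Proof. exact: xgetPex (l2_inner_sum (l2valP f) (l2valP g)). Qed.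

Lemma l2_inner_eq f g l :
  has_sum (fun x => l2val f x * conjc (l2val g x)) l -> l2_inner f g = l.
Proof. exact/has_sum_unique/l2_innerP. Qed.

Lemma l2_innerDl a f g h :
  l2_inner (a *: f + g) h = a * l2_inner f h + l2_inner g h.
Proof.
apply: l2_inner_eq; have := has_sum_lin a (l2_innerP f h) (l2_innerP g h).
by congr has_sum; apply/funext => x; rewrite l2val_lin mulrDl mulrA.
Qed.

Lemma l2_innerC f g : l2_inner g f = conjc (l2_inner f g).
Proof.
apply: l2_inner_eq; have := has_sum_conj (l2_innerP f g).
by congr has_sum; apply/funext => x; rewrite rmorphM /= conjcK mulrC.
Qed.

Lemma l2_inner_self f : exists2 s : R, l2_inner f f = s%:C &
  (forall F : {fset X}, \sum_(x <- F) sqn (l2val f x) <= s) /\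
  (forall N, (forall F : {fset X}, \sum_(x <- F) sqn (l2val f x) <= N) -> s <= N).
Proof.
have [M hM] := l2valP f.
have [s hs ub] := has_sum_nonneg (fun x => sqn_ge0 (l2val f x)) hM.
exists s => //; apply: l2_inner_eq; move: hs; congr has_sum.
by apply/funext => x; rewrite mulJ_sqn.
Qed.

Lemma l2_inner_ge0 f : 0 <= l2_inner f f.
Proof.
have [s -> [/(_ fset0) ub _]] := l2_inner_self f.
by rewrite ler0c; move: ub; rewrite big_nil.
Qed.

Lemma l2_inner_eq0 f : l2_inner f f = 0 -> f = 0.
Proof.
have [s -> [ub _]] := l2_inner_self f => -[s0]; rewrite {s}s0 in ub.
apply: val_inj; apply/funext => x /=; apply: sqn_eq0; apply/eqP.
rewrite eq_le sqn_ge0 andbT; have := ub [fset x]%fset.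
by rewrite big_seq_fset1.
Qed.

(** The limit is the supremum of the numbers that are eventually below the sequence. *)
Lemma real_cauchy_cvg (a : nat -> R) :
  (forall e, 0 < e -> exists N, forall m n, (N <= m)%N -> (N <= n)%N ->
    (a m - a n) ^+ 2 <= e) ->
  exists l, forall e, 0 < e -> exists N, forall n, (N <= n)%N ->
    (a n - l) ^+ 2 <= e.
Proof.
move=> ca.
have {}ca e : 0 < e -> exists N, forall m n, (N <= m)%N -> (N <= n)%N ->
    a m - a n <= e.
  move=> e0; have [|N hN] := ca (e ^+ 2); first by rewrite exprn_gt0.
  exists N => m n /hN Nm /Nm h; rewrite leNgt; apply/negP => lt; nra.
pose E : set R := fun t => exists N, forall n, (N <= n)%N -> t <= a n.
have lb e N : (forall m n, (N <= m)%N -> (N <= n)%N -> a m - a n <= e) ->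
    E (a N - e).
  by move=> h; exists N => n Nn; have := h N n (leqnn _) Nn; lra.
have ub e N : (forall m n, (N <= m)%N -> (N <= n)%N -> a m - a n <= e) ->
    ubound E (a N + e).
  move=> h t [N' hN']; have := hN' (maxn N N') (leq_maxr _ _).
  by have := h _ N (leq_maxl N N') (leqnn _); lra.
have supE : has_sup E.
  have [N h] := ca 1 ltr01; split; first by exists (a N - 1); exact: lb.
  by exists (a N + 1); exact: ub.
exists (sup E) => e e0; pose d := Num.min 1 e.
have d0 : 0 < d by rewrite lt_min ltr01.
have d1 : d <= 1 by rewrite ge_min lexx.
have de : d <= e by rewrite ge_min lexx orbT.
have [|N h] := ca (d / 4); first by rewrite divr_gt0.
exists N => n Nn; have h1 := h n N Nn (leqnn _); have h2 := h N n (leqnn _) Nn.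
have h3 := sup_upper_bound supE (lb _ _ h).
have h4 : sup E <= a N + d / 4 by apply: ge_sup; [exact: supE.1 | exact: ub].
move: (sup E) (a N) (a n) h1 h2 h3 h4 => s x y h1 h2 h3 h4; nra.
Qed.

Lemma l2_complete (u : nat -> l2space) :
  (forall e : R[i], 0 < e -> exists N : nat, forall m n : nat,
    (N <= m)%N -> (N <= n)%N -> l2_inner (u m - u n) (u m - u n) < e) ->
  exists f, forall e : R[i], 0 < e -> exists N : nat, forall n : nat,
    (N <= n)%N -> l2_inner (u n - f) (u n - f) < e.
Proof.
move=> cu.
have {}cu (e : R) : 0 < e -> exists N, forall m n, (N <= m)%N -> (N <= n)%N ->
    forall F : {fset X}, \sum_(x <- F) sqn (l2val (u m) x - l2val (u n) x) <= e.
  move=> e0; have [|N hN] := cu e%:C; first by rewrite ltcR.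
  exists N => m n /hN Nm /Nm; have [s -> [ub _]] := l2_inner_self (u m - u n).
  by rewrite ltcR => /ltW se F; exact: le_trans (ub F) se.
have [x|f fP] := @choice _ _ (fun x l => forall e : R, 0 < e -> exists N,
    forall n, (N <= n)%N -> sqn (l2val (u n) x - l) <= e).
  have cx (e : R) : 0 < e -> exists N, forall m n, (N <= m)%N -> (N <= n)%N ->
      sqn (l2val (u m) x - l2val (u n) x) <= e.
    move=> /cu [N hN]; exists N => m n Nm Nn.
    by have := hN _ _ Nm Nn [fset x]%fset; rewrite big_seq_fset1.
  have ReB (a b : R[i]) : complex.Re (a - b) = complex.Re a - complex.Re b.
    by case: a b => a1 a2 [].
  have ImB (a b : R[i]) : complex.Im (a - b) = complex.Im a - complex.Im b.
    by case: a b => a1 a2 [].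
  have [e e0|r hr] := @real_cauchy_cvg (fun n => complex.Re (l2val (u n) x)).
    have [N hN] := cx _ e0; exists N => m n /hN Nm /Nm.
    rewrite -ReB; apply: le_trans; rewrite /sqn; have := sqr_ge0 (complex.Im
      (l2val (u m) x - l2val (u n) x)); lra.
  have [e e0|i hi] := @real_cauchy_cvg (fun n => complex.Im (l2val (u n) x)).
    have [N hN] := cx _ e0; exists N => m n /hN Nm /Nm.
    rewrite -ImB; apply: le_trans; rewrite /sqn; have := sqr_ge0 (complex.Re
      (l2val (u m) x - l2val (u n) x)); lra.
  exists (r +i* i) => e e0; have e2 : 0 < e / 2 by rewrite divr_gt0.
  have [N hN] := hr _ e2; have [N' hN'] := hi _ e2; exists (maxn N N') => n.
  rewrite geq_max => /andP[/hN h1 /hN' h2]; rewrite /sqn ReB ImB /=; lra.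
have cvF (s : seq X) (e : R) : 0 < e -> exists N, forall n, (N <= n)%N ->
    \sum_(x <- s) sqn (l2val (u n) x - f x) <= e.
  elim: s e => [|x s IH] e e0; first by exists 0%N => n _; rewrite big_nil ltW.
  have e2 : 0 < e / 2 by rewrite divr_gt0.
  have [N hN] := IH _ e2; have [N' hN'] := fP x _ e2.
  exists (maxn N N') => n; rewrite geq_max => /andP[/hN h1 /hN' h2].
  by rewrite big_cons; lra.
(* The rank must not depend on [F]: [u m] is compared with some [u n], where only the auxiliary [n]
   depends on [F]. *)
have cv (e : R) : 0 < e -> exists N, forall n, (N <= n)%N -> forall F : {fset X},
    \sum_(x <- F) sqn (l2val (u n) x - f x) <= e.
  move=> e0; have e4 : 0 < e / 4 by rewrite divr_gt0.
  have [N hN] := cu _ e4; exists N => m Nm F.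
  have [N' hN'] := cvF F _ e4; have [Nn N'n] := (leq_maxl N N', leq_maxr N N').
  move: (maxn N N') Nn N'n => n /(hN _ _ Nm)/(_ F) h1 /hN' h2.
  apply: (@le_trans _ _ (\sum_(x <- F)
    (2 * sqn (l2val (u m) x - l2val (u n) x) + 2 * sqn (l2val (u n) x - f x)))).
    apply: ler_sum => x _; apply: le_trans (sqnD_le _ _).
    by rewrite addrA subrK.
  by rewrite big_split -!mulr_sumr /=; lra.
have lf : f \in l2_pred.
  apply/l2_predP; have [N hN] := cv 1 ltr01.
  have : l2 (fun x => l2val (u N) x - f x) by exists 1; exact: hN.
  move=> /(l2_lin (-1))/(_ (l2valP (u N))); congr l2.
  by apply/funext => x; rewrite mulN1r opprB subrK.
exists (L2Space lf) => e; rewrite ltcE => /andP[/eqP e1 e2].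
have -> : e = (complex.Re e)%:C by case: (e) e1 => a b /= ->.
move: (complex.Re e) e2 => {e e1} e e0.
have e2 : 0 < e / 2 by rewrite divr_gt0.
have [N hN] := cv _ e2; exists N => n Nn.
have [s -> [_ /(_ (e / 2))]] := l2_inner_self (u n - L2Space lf).
by move=> /(_ (hN _ Nn)) se; rewrite ltcR; lra.
Qed.

Definition l2_hilbert : hilbert R :=
  Hilbert l2_innerDl l2_innerC l2_inner_ge0 l2_inner_eq0 l2_complete.

End L2Space.

(** * Simple functions as multiplication operators *)

Section Multiplication.
Variables (R : realType) (X : choiceType).
Implicit Types (g h : X -> R[i]) (f : l2space R X).

Definition bounded_fun g : Prop := exists M : R, forall x, sqn (g x) <= M.

(** The default 0 makes the operator total in [g]; for bounded [g] the product is square-summable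
    and the default never occurs. *)
Definition l2_mul g : op (l2_hilbert R X) :=
  fun f => insubd (0 : l2space R X) (fun x => g x * l2val f x).

Lemma l2val_mul g f x : bounded_fun g -> l2val (l2_mul g f) x = g x * l2val f x.
Proof.
move=> [M gM]; rewrite [l2val _]val_insubd.
by have /l2_predP -> := l2_bounded_mul gM (l2valP f).
Qed.

Lemma l2_ext f f' : (forall x, l2val f x = l2val f' x) -> f = f'.
Proof. by move=> e; apply: val_inj; apply/funext. Qed.

Lemma l2_mul_bounded g : bounded_fun g -> bounded_op (l2_mul g).
Proof.
move=> bg; split=> [a f f'|].
  by apply: l2_ext => x; rewrite l2val_lin !l2val_mul // l2val_lin mulrDr mulrCA.
have [M gM] := bg; exists `|M|%:C => f /=.
have [s -> [_ le_s]] := l2_inner_self (l2_mul g f).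
have [t -> [ub _]] := l2_inner_self f.
rewrite -rmorphM lecR; apply: le_s => F.
apply: (@le_trans _ _ (`|M| * \sum_(x <- F) sqn (l2val f x))).
  rewrite mulr_sumr; apply: ler_sum => x _; rewrite l2val_mul // sqnM.
  by rewrite ler_wpM2r ?sqn_ge0 // (le_trans (gM x)) ?ler_norm.
by rewrite ler_wpM2l.
Qed.

Lemma l2_mul_adjoint g : bounded_fun g ->
  is_adjoint (l2_mul g) (l2_mul (fun x => conjc (g x))).
Proof.
move=> bg f f' /=.
have bg' : bounded_fun (fun x => conjc (g x)).
  by have [M gM] := bg; exists M => x; rewrite sqnJ.
apply: l2_inner_eq; have := l2_innerP f (l2_mul (fun x => conjc (g x)) f').
congr has_sum; apply/funext => x.
by rewrite !l2val_mul // rmorphM /= conjcK mulrCA mulrA.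
Qed.

Definition delta_fun (y x : X) : R[i] := (x == y)%:R.

Lemma delta_l2 y : delta_fun y \in @l2_pred R X.
Proof.
apply/l2_predP; exists (sqn (1 : R[i])) => F.
have yF : y \in (y |` F)%fset by rewrite !inE eqxx.
apply: (le_trans (sum_fset_le _ (fsubsetU1 y F))) => [x|]; first exact: sqn_ge0.
rewrite (big_fsetD1 y) //= /delta_fun eqxx big_seq big1 ?addr0 // => x.
by rewrite !inE => /andP[/negbTE -> _]; exact: sqn0.
Qed.

(** Point masses recover the values of the multiplier. *)
Lemma l2_mul_inj g h : bounded_fun g -> bounded_fun h ->
  l2_mul g = l2_mul h -> g = h.
Proof.
move=> bg bh e; apply/funext => x.
have := congr1 (fun T => l2val (T (L2Space (delta_l2 x))) x) e.
by rewrite !l2val_mul //= /delta_fun eqxx !mulr1.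
Qed.

Variable S : (X -> Prop) -> Prop.
Hypothesis hS : gen_field_of_sets S.

(** The level set of 0 is exempt because [X] itself need not belong to [S]. *)
Definition simple g : Prop :=
  (exists s : seq R[i], forall x, g x \in s) /\
  (forall z, z != 0 -> S (fun x => g x = z)).

Lemma field_set0 : S (fun=> False).
Proof.
have [[s Ss] hop] := hS; have [_ _] := hop _ _ Ss Ss; congr S.
by apply/funext => x; apply/propext; split=> // -[].
Qed.

Lemma field_setU (I : eqType) (r : seq I) (Q : I -> X -> Prop) :
  (forall i, i \in r -> S (Q i)) -> S (fun x => exists2 i, i \in r & Q i x).
Proof.
elim: r => [_|i r IH Qr].
  by have := field_set0; congr S; apply/funext => x; apply/propext; split=> // -[].
have Si : S (Q i) by apply: Qr; rewrite mem_head.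
have Sr : S (fun x => exists2 i, i \in r & Q i x).
  by apply: IH => j jr; apply: Qr; rewrite inE jr orbT.
have [_ + _] := hS.2 _ _ Si Sr; congr S; apply/funext => x; apply/propext; split.
  move=> [Qi|[j jr Qj]]; first by exists i; rewrite ?mem_head.
  by exists j; rewrite ?inE ?jr ?orbT.
by move=> [j]; rewrite inE => /orP[/eqP -> Qi|jr Qj]; [left | right; exists j].
Qed.

Lemma simple_bounded g : simple g -> bounded_fun g.
Proof.
move=> [[s gs] _]; exists (\sum_(z <- s) sqn z) => x.
move: (g x) (gs x) => {gs}; elim: s => // z s IH w.
rewrite inE big_cons => /orP[/eqP ->|/IH h].
  by rewrite lerDl sumr_ge0 // => v _; exact: sqn_ge0.
by rewrite (le_trans h) // lerDr sqn_ge0.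
Qed.

Lemma simple_support g : simple g -> S (fun x => g x <> 0).
Proof.
move=> [[s gs] gS]; have := @field_setU _ [seq z <- s | z != 0] (fun z x => g x = z).
set Y := (fun x => exists2 z, _ & _) => SY.
have -> : (fun x => g x <> 0) = Y; last first.
  by apply: SY => z; rewrite mem_filter => /andP[z0 _]; exact: gS.
apply/funext => x; apply/propext; split=> [/eqP g0|[z]].
  by exists (g x); rewrite // mem_filter g0 gs.
by rewrite mem_filter => /andP[z0 _] ->; exact/eqP.
Qed.

(** A nonzero level set of the result is a finite union of intersections of level sets, never both
    at 0 because [k 0 0 = 0]. When one value is 0, the intersection is a difference with a
    support. *)
Lemma simple_op (k : R[i] -> R[i] -> R[i]) g h : k 0 0 = 0 ->
  simple g -> simple h -> simple (fun x => k (g x) (h x)).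
Proof.
move=> k0 sg sh; have [[s gs] gS] := sg; have [[t ht] hSh] := sh; split.
  by exists [seq k a b | a <- s, b <- t] => x; apply: allpairs_f.
move=> z z0; pose r := [seq ab <- [seq (a, b) | a <- s, b <- t] | k ab.1 ab.2 == z].
have -> : (fun x => k (g x) (h x) = z) =
    (fun x => exists2 ab, ab \in r & g x = ab.1 /\ h x = ab.2).
  apply/funext => x; apply/propext; split=> [kz|[[a b]]].
    exists (g x, h x) => //; rewrite mem_filter /= kz eqxx /=.
    exact: allpairs_f.
  by rewrite mem_filter /= => /andP[/eqP <- _] [-> ->].
apply: field_setU => -[a b]; rewrite mem_filter /= => /andP[/eqP kz _].
have [a0|a0] := eqVneq a 0; have [b0|b0] := eqVneq b 0.
- by move: z0; rewrite -kz a0 b0 k0 eqxx.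
- have [_ _] := hS.2 _ _ (hSh _ b0) (simple_support sg); congr S.
  apply/funext => x; apply/propext; rewrite a0.
  by split=> [[-> /contrapT ->] //|[-> ->]]; split=> // /(_ erefl).
- have [_ _] := hS.2 _ _ (gS _ a0) (simple_support sh); congr S.
  apply/funext => x; apply/propext; rewrite b0.
  by split=> [[-> /contrapT ->] //|[-> ->]]; split=> // /(_ erefl).
- by have [+ _ _] := hS.2 _ _ (gS _ a0) (hSh _ b0).
Qed.

Definition simple_alg (T : op (l2_hilbert R X)) : Prop :=
  exists2 g, simple g & T = l2_mul g.

Lemma l2_mul_comp g h : bounded_fun g -> bounded_fun h ->
  bounded_fun (fun x => g x * h x) ->
  l2_mul g \o l2_mul h = l2_mul (fun x => g x * h x).
Proof.
move=> bg bh bgh; apply/funext => f; apply: l2_ext => x /=.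
by rewrite !l2val_mul // mulrA.
Qed.

Lemma simpleM g h : simple g -> simple h -> simple (fun x => g x * h x).
Proof. by apply: simple_op; rewrite mul0r. Qed.

Lemma simple_compE g h : simple g -> simple h ->
  l2_mul g \o l2_mul h = l2_mul (fun x => g x * h x).
Proof.
by move=> sg sh; apply: l2_mul_comp; apply: simple_bounded => //; exact: simpleM.
Qed.

Lemma simple_alg_comm : commutative_alg simple_alg.
Proof.
move=> _ _ [g sg ->] [h sh ->]; rewrite !simple_compE //.
by congr l2_mul; apply/funext => x; rewrite mulrC.
Qed.

Lemma simple_alg_Rstar : Rstar_alg simple_alg.
Proof.
split.
- by move=> _ [g sg ->]; exact/l2_mul_bounded/simple_bounded.
- split.
    have s0 : simple (fun=> 0).
      split; first by exists [:: 0] => x; rewrite inE.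
      move=> z z0; have := field_set0; congr S; apply/funext => x; apply/propext.
      by split=> // e; move: z0; rewrite e eqxx.
    exists (fun=> 0) => //; apply/funext => f; apply: l2_ext => x.
    by rewrite l2val_mul ?mul0r //; exact: simple_bounded.
  move=> a _ _ [g sg ->] [h sh ->].
  have sk : simple (fun x => a * g x + h x).
    by apply: (@simple_op (fun u v => a * u + v)) => //; rewrite mulr0 addr0.
  exists (fun x => a * g x + h x) => //; apply/funext => f; apply: l2_ext => x.
  rewrite l2val_lin !l2val_mul; try exact: simple_bounded.
  by rewrite mulrDl mulrA.
- move=> _ _ [g sg ->] [h sh ->]; exists (fun x => g x * h x); first exact: simpleM.
  exact: simple_compE.
- move=> _ [g sg ->]; exists (l2_mul (fun x => conjc (g x))); split.
    exists (fun x => conjc (g x)) => //.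
    exact: (@simple_op (fun u _ => conjc u) _ _ (conjc0 R) sg sg).
  exact/l2_mul_adjoint/simple_bounded.
(* The convention that 0 has inverse 0 makes the pointwise inverse a quasi-inverse that is again
   simple. *)
- move=> _ [g sg ->]; exists (l2_mul (fun x => (g x)^-1)).
  have si : simple (fun x => (g x)^-1).
    exact: (@simple_op (fun u _ => u^-1) _ _ (invr0 _) sg sg).
  split; first by exists (fun x => (g x)^-1).
  rewrite (simple_compE sg si) simple_compE //; last exact: simpleM.
  congr l2_mul; apply/funext => x.
  by have [->|g0] := eqVneq (g x) 0; rewrite ?mulr0 // divff // mul1r.
Qed.

Definition char_fun (s : X -> Prop) (x : X) : R[i] := (`[< s x >])%:R.

Lemma simple_char s : S s -> simple (char_fun s).
Proof.
move=> Ss; split.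
  by exists [:: 0; 1] => x; rewrite /char_fun !inE; case: asboolP; rewrite eqxx ?orbT.
move=> z z0; have [z1|z1] := eqVneq z 1.
  move: Ss; congr S; apply/funext => x; apply/propext; rewrite z1 /char_fun.
  by case: asboolP => sx; split=> // /esym/eqP; rewrite oner_eq0.
have := field_set0; congr S; apply/funext => x; apply/propext.
split=> // e; move: z0 z1; rewrite -e /char_fun.
by case: asboolP; rewrite eqxx.
Qed.

Lemma simple_alg_order_iso :
  order_iso S (@set_incl X) (projs simple_alg) (@proj_le R (l2_hilbert R X)).
Proof.
exists (fun s => l2_mul (char_fun s)); split.
- move=> s Ss; have sc := simple_char Ss.
  apply: (projs_idem simple_alg_Rstar simple_alg_comm) => [|f].
    by exists (char_fun s).
  apply: l2_ext => x; rewrite !l2val_mul; try exact: simple_bounded.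
  by rewrite mulrA /char_fun; case: asboolP; rewrite ?mul1r ?mul0r.
- move=> s t /simple_char/simple_bounded bs /simple_char/simple_bounded bt.
  move=> /(l2_mul_inj bs bt) e; apply/funext => x; apply/propext.
  have := congr1 (fun g => g x == 1) e; rewrite /char_fun.
  by case: asboolP; case: asboolP; rewrite ?eqxx // eq_sym oner_eq0.
- move=> T [[g sg ->] [gg _]].
  have idg x : g x * g x = g x.
    have bgg := simple_bounded (simpleM sg sg); move: gg.
    rewrite simple_compE // => /(l2_mul_inj bgg (simple_bounded sg)) gg.
    exact: (congr1 (@^~ x) gg).
  exists (fun x => g x = 1); split; first by case: sg => _; apply; exact: oner_neq0.
  congr l2_mul; apply/funext => x; rewrite /char_fun.
  case: asboolP => [-> //|g1]; have /eqP := idg x.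
  rewrite -subr_eq0 -{3}[g x]mulr1 -mulrBr mulf_eq0 subr_eq0.
  by case/orP => /eqP // ->.
- move=> s t /simple_char sc /simple_char tc; rewrite /proj_le simple_compE //.
  split=> [st|].
    congr l2_mul; apply/funext => x; rewrite /char_fun.
    case: asboolP => [/st tx|_]; last by rewrite mul0r.
    by rewrite asboolT // mulr1.
  have bst := simple_bounded (simpleM sc tc).
  move=> /(l2_mul_inj bst (simple_bounded sc)) e x sx.
  have := congr1 (@^~ x) e; rewrite /char_fun (asboolT sx) mul1r.
  by case: asboolP => // _ /esym/eqP; rewrite oner_eq0.
Qed.

End Multiplication.

Theorem theorem4p3 (R : realType) :
  [/\ (* (a) *)
      (forall (H : hilbert R) (A : op H -> Prop),
         Rstar_alg A -> commutative_alg A ->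
         is_gen_boolean (projs A) (@proj_le R H)),
      (* (b) *)
      (forall (T : Type) (D : T -> Prop) (le : T -> T -> Prop),
         is_gen_boolean D le ->
         exists (H : hilbert R) (A : op H -> Prop),
           [/\ Rstar_alg A, commutative_alg A &
               order_iso D le (projs A) (@proj_le R H)]),
      (* (c) *)
      (forall (H1 H2 : hilbert R) (A : op H1 -> Prop) (B : op H2 -> Prop),
         Rstar_alg A -> commutative_alg A ->
         Rstar_alg B -> commutative_alg B ->
         (star_iso A B <->
          order_iso (projs A) (@proj_le R H1) (projs B) (@proj_le R H2))) &
      (* (d) *)
      (forall (H : hilbert R) (A : op H -> Prop),
         Rstar_alg A -> commutative_alg A ->
         (unital_alg A <-> is_boolean (projs A) (@proj_le R H)))].
Proof.
split=> [H A hA cA|T D le [X [S [hS iso]]]|H1 H2 A B hA cA hB cB|H A hA cA].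
- exact: projs_gen_boolean.
(* [{classic X}] supplies the choice structure needed for finite subsets of an arbitrary type. *)
- exists (l2_hilbert R {classic X}), (@simple_alg R {classic X} S); split.
  + exact: simple_alg_Rstar.
  + exact: simple_alg_comm.
  + exact: order_iso_trans iso (@simple_alg_order_iso R {classic X} S hS).
- split; first exact: star_iso_projs.
  exact: order_iso_star.
- split=> [/(unital_top hA cA) [e Pe top]|/boolean_has_top top].
    exact: is_boolean_top (projs_gen_boolean hA cA) Pe top.
  exact/(unital_top hA cA).
Qed.
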